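(* Let $(E,e,T)$ be a conditional Riesz triple, let $1\leq p<\infty$, let $(f_n)$ be a sequence in $L^p(T)$ and let $f\in L^1(T)$. Then the following statements are equivalent. (i) $f\in L^p(T)$ and $(f_n)$ converges to $f$ in $L^p(T)$, i.e. $N_p(f_n-f)\to0$ in order. (ii) The sequence $(|f_n|^p)$ is $T$-uniform and $(f_n)$ converges to $f$ in $T$-conditional probability.
   Context: A conditional Riesz triple $(E,e,T)$ consists of a Dedekind complete Riesz space (vector lattice) $E$, a weak order unit $e$ of $E$, and a conditional expectation operator $T$ on $E$, i.e. an order continuous, strictly positive ($x>0$ implies $Tx>0$) linear projection $T:E\to E$ whose range $R(T)$ is a Dedekind complete Riesz subspace of $E$, with $Te=e$. $E^u$ denotes the universal completion of $E$, equipped with its unique $f$-algebra multiplication with identity $e$; real powers $y^r$ ($r>0$) of elements $y\in E^u_+$ are taken in $E^u$ (functional calculus relative to $e$). The natural domain $L^1(T)$ of $T$ is $D-D$, where $D$ is the set of all $x\in E^u_+$ for which there is an increasing net $(x_\alpha)$ in $E_+$ with $x_\alpha\uparrow x$ in $E^u$ and $(Tx_\alpha)$ order bounded in $E^u$; $T$ extends uniquely to a conditional expectation operator on $L^1(T)$, given on $D$ by $Tx=\sup_\alpha Tx_\alpha$. From now on $T$ denotes this extension and $R(T)$ its range. For $1\le p<\infty$, $L^p(T)=\{x\in L^1(T): |x|^p\in L^1(T)\}$ and $N_p(x)=(T|x|^p)^{1/p}\in R(T)$. For an element $y$, $P_y$ denotes the band projection onto the band generated by $y$. Order convergence: a net $(x_\alpha)$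 converges in order to $x$ if there is a net $(v_\gamma)$ with $v_\gamma\downarrow 0$ such that for every $\gamma$ there is $\alpha_0$ with $|x_\alpha-x|\le v_\gamma$ for all $\alpha\ge\alpha_0$; it is taken in $L^1(T)$. A net $(x_\alpha)$ converges to $x$ in $T$-conditional probability if for every real $\varepsilon>0$, $TP_{(|x_\alpha-x|-\varepsilon e)^+}e\to0$ in order. A family $A\subset L^1(T)$ is $T$-uniform if $\sup_{x\in A}TP_{(|x|-ce)^+}|x|\to0$ in order as the real number $c\to\infty$ (in particular these suprema exist in $L^1(T)$ for all large $c$). *)

(* Defs.v *)
From HB Require Import structures.
From mathcomp Require Import all_boot all_order all_algebra.
From mathcomp Require Import boolp classical_sets reals exp.
Set Implicit Arguments.
Unset Strict Implicit.
Unset Printing Implicit Defensive.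
Import Order.TTheory GRing.Theory Num.Theory.
Local Open Scope classical_set_scope.
Local Open Scope ring_scope.

(* The lattice operations are fields here: Hierarchy-Builder rejects a join of
   Order.Lattice and GRing.Zmodule declared after Num.RealDomain. *)
HB.mixin Record Lmodule_isRiesz (R : realType) V
    of Num.POrderedZmodule V & GRing.Lmodule R V := {
  riesz_lerD2r : forall z x y : V, x <= y -> x + z <= y + z;
  riesz_scaler_ge0 : forall (a : R) (x : V), 0 <= a -> 0 <= x -> 0 <= a *: x;
  rjoin : V -> V -> V;
  rmeet : V -> V -> V;
  rjoin_le : forall x y z : V, (rjoin x y <= z) = (x <= z) && (y <= z);
  le_rmeet : forall x y z : V, (z <= rmeet x y) = (z <= x) && (z <= y)
}.

#[short(type="rieszType")]
HB.structure Definition Riesz (R : realType) :=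
  { V of Num.POrderedZmodule V & GRing.Lmodule R V & Lmodule_isRiesz R V }.

Section RieszSpaces.
Context {R : realType} {V : rieszType R}.
Implicit Types (x y z : V) (L A B : set V).

Definition rabs x : V := rjoin x (- x).
Definition rpos x : V := rjoin x 0.
Definition rdisjoint x y : Prop := rmeet (rabs x) (rabs y) = 0.

(* Supremum and infimum computed in a subset L of V with the induced order. *)
Definition is_sup_in L A z :=
  [/\ L z, ubound A z & forall w, L w -> ubound A w -> z <= w].
Definition is_inf_in L A z :=
  [/\ L z, lbound A z & forall w, L w -> lbound A w -> w <= z].

Definition dedekind_complete L :=
  forall A, A `<=` L -> A !=set0 -> (exists2 b, L b & ubound A b) ->
    exists z, is_sup_in L A z.

Definition laterally_complete :=
  forall A, A !=set0 -> (forall x, A x -> 0 <= x) ->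
    (forall x y, A x -> A y -> x <> y -> rdisjoint x y) ->
    exists z, supremums A z.

Definition is_ideal B :=
  [/\ B 0,
      forall (a : R) x y, B x -> B y -> B (a *: x + y)
    & forall x y, B x -> rabs y <= rabs x -> B y].

Definition is_band B :=
  is_ideal B /\ forall A z, A `<=` B -> supremums A z -> B z.

Definition band_of y : set V := smallest is_band [set y].

(* The component of x in the band generated by y, along its disjoint
   complement; it exists and is unique in a Dedekind complete space. *)
Definition band_proj y x : V :=
  xget 0 [set b | band_of y b /\ forall c, band_of y c -> rdisjoint (x - b) c].

Definition weak_order_unit (e : V) := 0 <= e /\ band_of e = [set: V].

End RieszSpaces.

Definition directed (I : Type) (leI : I -> I -> Prop) :=
  [/\ inhabited I,
      forall i, leI i i,
      forall i j k, leI i j -> leI j k -> leI i k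
    & forall i j, exists k, leI i k /\ leI j k].

(* Order convergence, in the subspace L of V, of a net x indexed by (I, leI). *)
Definition order_cvg (R : realType) (V : rieszType R) (L : set V)
    (I : Type) (leI : I -> I -> Prop) (x : I -> V) (l : V) :=
  exists (J : Type) (leJ : J -> J -> Prop) (v : J -> V),
    [/\ directed leJ,
        forall j k, leJ j k -> v k <= v j,
        range v `<=` L /\ is_inf_in L (range v) 0
      & forall j, exists i0, forall i, leI i0 i -> rabs (x i - l) <= v j].

Section FunctionalCalculus.
Context {R : realType} {V : rieszType R} (e : V).

(* The component of e on which y > t. *)
Definition spectral (y : V) (t : R) : V := band_proj (rpos (y - t *: e)) e.

(* g(y) relative to e, for y >= 0 and g continuous and nonnegative on
   [0, +oo[: the spectral integral of g against the spectral system of y, as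
   the supremum of the lower step elements; here spectral y a - spectral y b is
   the component of e on which a < y <= b. A left endpoint a < 0 makes the
   value 0 of y count. Each element below is a single step: a finite sum of
   steps over disjoint intervals is the supremum of its terms, so that sums
   would give the same supremum. *)
Definition fcalc (g : R -> R) (y : V) : V :=
  supremum 0 [set z | exists a b c : R,
    [/\ a < b, 0 <= c,
        forall t, 0 <= t -> a < t -> t <= b -> c <= g t
      & z = c *: (spectral y a - spectral y b)]].

Definition rpow (y : V) (r : R) : V := fcalc (fun t => t `^ r) y.

End FunctionalCalculus.

Section ConditionalTriple.
Context {R : realType} {E : rieszType R}.

Definition order_continuous (T : E -> E) :=
  forall (I : Type) (leI : I -> I -> Prop) (x : I -> E) (l : E),
    directed leI -> order_cvg setT leI x l ->
    order_cvg setT leI (T \o x) (T l).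

Record conditional_expectation (e : E) (T : {linear E -> E}) : Prop := {
  ce_proj : forall x, T (T x) = T x;
  ce_order_continuous : order_continuous T;
  ce_strictly_positive : forall x, 0 < x -> 0 < T x;
  ce_range_riesz : forall x y, range T x -> range T y ->
    range T (rjoin x y) /\ range T (rmeet x y);
  ce_range_complete : dedekind_complete (range T);
  ce_unit : T e = e
}.

Record conditional_riesz_triple (e : E) (T : {linear E -> E}) : Prop := {
  crt_complete : dedekind_complete [set: E];
  crt_unit : weak_order_unit e;
  crt_ce : conditional_expectation e T
}.

Record universal_completion (Eu : rieszType R) (iota : {linear E -> Eu}) :
    Prop := {
  uc_complete : dedekind_complete [set: Eu];
  uc_laterally_complete : @laterally_complete R Eu;
  uc_inj : injective iota;
  uc_join : forall x y, iota (rjoin x y) = rjoin (iota x) (iota y);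
  uc_meet : forall x y, iota (rmeet x y) = rmeet (iota x) (iota y);
  uc_order_dense : forall u : Eu, 0 < u -> exists x : E, 0 < iota x <= u
}.

End ConditionalTriple.

Section NaturalDomain.
Context {R : realType} {E Eu : rieszType R}.
Variables (iota : {linear E -> Eu}) (e : E) (T : {linear E -> E}).
Implicit Types (x y : Eu).

Record approx_net (I : Type) (leI : I -> I -> Prop) (a : I -> E) x : Prop := {
  approx_directed : directed leI;
  approx_ge0 : forall i, 0 <= a i;
  approx_incr : forall i j, leI i j -> a i <= a j;
  approx_sup : supremums (range (iota \o a)) x;
  approx_bounded : exists b c : Eu, forall i, b <= iota (T (a i)) <= c
}.

Definition nat_dom_pos : set Eu :=
  [set x | 0 <= x /\
    exists (I : Type) (leI : I -> I -> Prop) (a : I -> E), approx_net leI a x].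

(* The natural domain of T. *)
Definition L1 : set Eu :=
  [set x | exists u v, [/\ nat_dom_pos u, nat_dom_pos v & x = u - v]].

(* Graph of the extension of T to nat_dom_pos. *)
Definition ext_pos x z : Prop :=
  exists (I : Type) (leI : I -> I -> Prop) (a : I -> E),
    approx_net leI a x /\ supremums (range (iota \o T \o a)) z.

(* The extension of T to L1; its values outside L1 are irrelevant. *)
Definition Text x : Eu :=
  xget 0 [set z | exists u v zu zv,
    [/\ ext_pos u zu, ext_pos v zv, x = u - v & z = zu - zv]].

Local Notation e' := (iota e).

Definition Lp (p : R) : set Eu := [set x | L1 x /\ L1 (rpow e' (rabs x) p)].

Definition Np (p : R) x : Eu := rpow e' (Text (rpow e' (rabs x) p)) p^-1.

Definition cvg_cond_prob (I : Type) (leI : I -> I -> Prop) (x_ : I -> Eu) x :=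
  forall eps : R, 0 < eps ->
    order_cvg L1 leI
      (fun i => Text (band_proj (rpos (rabs (x_ i - x) - eps *: e')) e')) 0.

(* T-uniformity: s is the net, indexed by the real number c, of the suprema;
   only its values for large c matter. *)
Definition T_uniform (A : set Eu) :=
  exists s : R -> Eu,
    (exists c0 : R, forall c, c0 <= c ->
      is_sup_in L1
        [set Text (band_proj (rpos (rabs x - c *: e')) (rabs x)) | x in A]
        (s c))
    /\ order_cvg L1 (fun c d : R => c <= d) s 0.

End NaturalDomain.

(* Main.v *)
Require Import Defs.
From HB Require Import structures.
From mathcomp Require Import all_boot all_order all_algebra.
From mathcomp Require Import boolp classical_sets reals exp.
From mathcomp Require Import ring.
Set Implicit Arguments.
Unset Strict Implicit.
Unset Printing Implicit Defensive.
Import Order.TTheory GRing.Theory Num.Theory.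
Local Open Scope classical_set_scope.
Local Open Scope ring_scope.

(** This is Vitali's convergence theorem with integrals replaced by [T]: split
    [|f_ n - f|^p] into a part where [|f_ n - f|] is small, a part controlled by
    the conditional probability that it is not, and a tail controlled by
    uniformity. Three points make the classical proof work in a Riesz space.

    Pointwise reasoning without points. For [q > 0], [le_on q x y] says that
    [rpos (x - y)] is disjoint from [q], that is, [x <= y] on the band generated
    by [q]. An inequality holds as soon as below every [q > 0] there is some
    [q' > 0] on which it holds ([le_global]). So, as one does at a point, one may
    pass to a smaller [q'] to decide whether [x <= y] or [y <= x]
    ([le_on_total]), whether a band projection acts as the identity or as zero
    ([band_proj_cases]), and to enclose elements between multiples of the unit
    ([locally_bounded], [power_grid]). Where [a *: e <= y <= b *: e], the power
    [rpow e y r] lies between [a `^ r *: e] and [b `^ r *: e] ([rpow_ge_on],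
    [rpow_le_on]), so every inequality between real powers that is needed
    transfers to [Eu].

    The extension of [T]. For [x >= 0] in [L1], [Text x] is the supremum of [T a]
    over all [a] in [E] with [0 <= a <= x]. Order continuity of [T] shows that any
    upward directed set increasing to [x] gives the same value
    ([T_below_approx]); additivity and monotone convergence ([Tpos_monotone])
    follow by choosing suitable directed sets. Monotone convergence gives
    [T (y - k e)^+ -> 0] ([Text_excess_null]), the only form of uniform
    integrability of a single element that is used.

    Order convergence to zero of a net is the statement that the set of its
    eventual bounds has infimum zero ([order_cvg0P]). A convergence proof thus
    exhibits a family of eventual bounds and removes their terms one at a time
    ([null_inf_le]).

    Finally [N_p] may be replaced by [T |f_ n - f|^p] ([root_cvg0]). One direction
    uses that a bound for the roots makes the supremum of a tail of
    [T |f_ n - f|^p] an element of [L1]: the range of [T] is closed under suprema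
    in [Eu] ([sup_range_dom]). *)

(** * Linear identities between vectors *)

Section LinearExpressions.
Context {R : realType} {V : lmodType R}.

Inductive lexp :=
  LVar of nat | LZero | LAdd of lexp & lexp | LOpp of lexp | LScale of R & lexp.

Fixpoint lval (env : seq V) s : V :=
  match s with
  | LVar i => nth 0 env i
  | LZero => 0
  | LAdd s1 s2 => lval env s1 + lval env s2
  | LOpp s1 => - lval env s1
  | LScale a s1 => a *: lval env s1
  end.

Fixpoint lcoef s (i : nat) : R :=
  match s with
  | LVar j => if Nat.eqb i j then 1 else 0
  | LZero => 0
  | LAdd s1 s2 => lcoef s1 i + lcoef s2 i
  | LOpp s1 => - lcoef s1 i
  | LScale a s1 => a * lcoef s1 i
  end.

Fixpoint eq_lcoef s1 s2 (n : nat) : Prop :=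
  if n is m.+1 then lcoef s1 m = lcoef s2 m /\ eq_lcoef s1 s2 m else True.

Lemma lvalE env s : lval env s = \sum_(i < size env) lcoef s i *: env`_i.
Proof.
elim: s => [j||s1 IH1 s2 IH2|s1 IH1|a s1 IH1] /=.
- have Ej i : Nat.eqb i j = (i == j) by apply/idP/eqP => /PeanoNat.Nat.eqb_eq.
  have [jn|nj] := ltnP j (size env).
    rewrite (bigD1 (Ordinal jn)) //= Ej eqxx scale1r big1 ?addr0 // => i.
    by rewrite -val_eqE /= Ej => /negbTE ->; rewrite scale0r.
  rewrite nth_default // big1 // => i _; rewrite Ej.
  by rewrite ltn_eqF ?scale0r // (leq_trans _ nj).
- by rewrite big1 // => i _; rewrite scale0r.
- by rewrite IH1 IH2 -big_split; apply: eq_bigr => i _; rewrite scalerDl.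
- by rewrite IH1 -sumrN; apply: eq_bigr => i _; rewrite scaleNr.
- by rewrite IH1 scaler_sumr; apply: eq_bigr => i _; rewrite scalerA.
Qed.

(** A linear identity between vectors follows from the equality of the
    coefficients of each variable, which is an identity of scalars. *)
Lemma lval_eq env s1 s2 :
  eq_lcoef s1 s2 (size env) -> lval env s1 = lval env s2.
Proof.
move=> H; rewrite !lvalE; apply: eq_bigr => -[i ilt] _ /=; congr (_ *: _).
elim: (size env) H i ilt => [_ []//|n IH /= [E H] i].
by rewrite ltnS leq_eqVlt => /predU1P[->//|]; exact: IH.
Qed.

End LinearExpressions.

(* Variables are compared by unification: different elaborations of the same
   term need not agree syntactically in their structure instances. *)
Ltac lsame u v := match goal with _ => unify u v end.
Ltac lmem v env :=
  lazymatch env with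
  | nil => constr:(false)
  | cons ?u ?t =>
      match goal with
      | _ => let _ := lsame u v in constr:(true)
      | _ => lmem v t
      end
  end.
Ltac lindex v env :=
  match env with
  | cons ?u _ => let _ := lsame u v in constr:(0%nat)
  | cons _ ?t => let n := lindex v t in constr:(S n)
  end.
Ltac lvars env s :=
  lazymatch s with
  | GRing.add ?a ?b => let env1 := lvars env a in lvars env1 b
  | GRing.opp ?a => lvars env a
  | GRing.scale _ ?a => lvars env a
  | GRing.zero => env
  | _ => lazymatch lmem s env with
         | true => env
         | false => constr:(cons s env)
         end
  end.
Ltac lreify R env s :=
  lazymatch s with
  | GRing.add ?a ?b =>
      let a1 := lreify R env a in let b1 := lreify R env b in
      constr:(LAdd a1 b1)
  | GRing.opp ?a => let a1 := lreify R env a in constr:(LOpp a1)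
  | GRing.scale ?k ?a =>
      let a1 := lreify R env a in constr:(@LScale R k a1)
  | GRing.zero => constr:(@LZero R)
  | _ => let n := lindex s env in constr:(@LVar R n)
  end.
(** Reduces a linear identity between vectors of a space over the [realType] of
    the context to the identities between the coefficients. *)
Ltac lmod_coef :=
  lazymatch goal with
  | R : realType |- @eq ?U ?x ?y =>
      let env0 := lvars (@nil U) x in
      let env := lvars env0 y in
      let s1 := lreify R env x in
      let s2 := lreify R env y in
      refine (@lval_eq R _ env s1 s2 _)
  end; cbn [eq_lcoef lcoef size Nat.eqb]; repeat split.

Ltac lmod := lmod_coef; ring.

(** * Riesz space identities *)

Section RieszTheory.
Context {R : realType} {V : rieszType R}.
Implicit Types x y z u v w c d : V.

(** Linear consequences of one or two inequalities; with the tactic [lmod] for the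
    last premise these two lemmas replace a decision procedure for linear
    arithmetic in ordered vector spaces. *)
Lemma le_lin1 a b x y : a <= b -> y - x = b - a -> x <= y.
Proof.
move=> ab E; have -> : y = b + (x - a).
  by apply: (addIr (- x)); rewrite E; lmod.
have {1}-> : x = a + (x - a) by lmod.
exact: riesz_lerD2r.
Qed.

Lemma le_lin2 a b c d x y :
  a <= b -> c <= d -> y - x = (b - a) + (d - c) -> x <= y.
Proof.
move=> ab cd E; apply: (@le_trans _ _ (x + (b - a))).
  by apply: (le_lin1 ab); lmod.
by apply: (le_lin1 cd); rewrite opprD addrA E; lmod.
Qed.

Lemma vsubr_ge0 x y : (0 <= y - x) = (x <= y).
Proof. by apply/idP/idP => /le_lin1; apply; lmod. Qed.

Lemma vscale_ge0 (a : R) x : 0 <= a -> 0 <= x -> 0 <= a *: x.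
Proof. exact: riesz_scaler_ge0. Qed.

Lemma vler_wZ (a : R) x y : 0 <= a -> x <= y -> a *: x <= a *: y.
Proof.
move=> a0; rewrite -vsubr_ge0 => /(vscale_ge0 a0) h.
by apply: (le_lin1 h); lmod.
Qed.

Lemma vler_pZ (a : R) x y : 0 < a -> (a *: x <= a *: y) = (x <= y).
Proof.
move=> a0; apply/idP/idP; last exact/vler_wZ/ltW.
have b0 : 0 <= a^-1 by rewrite invr_ge0 ltW.
by move/(vler_wZ b0); rewrite !scalerA mulVf ?gt_eqF// !scale1r.
Qed.

Lemma vleN x y : (- x <= - y) = (y <= x).
Proof. by apply/idP/idP => /le_lin1; apply; lmod. Qed.

Lemma vaddr_ge0 x y : 0 <= x -> 0 <= y -> 0 <= x + y.
Proof. by move=> x0 y0; apply: (le_lin2 x0 y0); lmod. Qed.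

Lemma rjoinl x y : x <= rjoin x y.
Proof. by have := lexx (rjoin x y); rewrite rjoin_le => /andP[]. Qed.
Lemma rjoinr x y : y <= rjoin x y.
Proof. by have := lexx (rjoin x y); rewrite rjoin_le => /andP[]. Qed.
Lemma rmeetl x y : rmeet x y <= x.
Proof. by have := lexx (rmeet x y); rewrite le_rmeet => /andP[]. Qed.
Lemma rmeetr x y : rmeet x y <= y.
Proof. by have := lexx (rmeet x y); rewrite le_rmeet => /andP[]. Qed.
Lemma rjoin_lub x y z : x <= z -> y <= z -> rjoin x y <= z.
Proof. by rewrite rjoin_le => -> ->. Qed.
Lemma rmeet_glb x y z : z <= x -> z <= y -> z <= rmeet x y.
Proof. by rewrite le_rmeet => -> ->. Qed.

Lemma rjoinC x y : rjoin x y = rjoin y x.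
Proof. by apply/eqP; rewrite eq_le !rjoin_le !rjoinl !rjoinr. Qed.
Lemma rmeetC x y : rmeet x y = rmeet y x.
Proof. by apply/eqP; rewrite eq_le !le_rmeet !rmeetl !rmeetr. Qed.

Lemma rmeet_le2 x y z w : x <= z -> y <= w -> rmeet x y <= rmeet z w.
Proof.
move=> xz yw; apply: rmeet_glb.
  exact: le_trans (rmeetl _ _) xz.
exact: le_trans (rmeetr _ _) yw.
Qed.
Lemma rjoin_le2 x y z w : x <= z -> y <= w -> rjoin x y <= rjoin z w.
Proof.
move=> xz yw; apply: rjoin_lub.
  exact: le_trans xz (rjoinl _ _).
exact: le_trans yw (rjoinr _ _).
Qed.

Lemma rmeet_idPl x y : reflect (rmeet x y = x) (x <= y).
Proof.
apply: (iffP idP) => [xy|<-]; last exact: rmeetr.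
by apply/eqP; rewrite eq_le rmeetl rmeet_glb.
Qed.

Lemma rmeetE x y : rmeet x y = x + y - rjoin x y.
Proof.
apply/eqP; rewrite eq_le; apply/andP; split; last first.
  by apply: rmeet_glb; [apply: (le_lin1 (rjoinr x y))|apply: (le_lin1 (rjoinl x y))];
    lmod.
have h : rjoin x y <= x + y - rmeet x y.
  by apply: rjoin_lub; [apply: (le_lin1 (rmeetr x y))|apply: (le_lin1 (rmeetl x y))];
    lmod.
by apply: (le_lin1 h); lmod.
Qed.

(** Translations are order automorphisms, hence commute with joins. *)
Lemma rjoinD x y z : rjoin x y + z = rjoin (x + z) (y + z).
Proof.
apply/eqP; rewrite eq_le; apply/andP; split; last first.
  by apply: rjoin_lub; [apply: (le_lin1 (rjoinl x y))|apply: (le_lin1 (rjoinr x y))];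
    lmod.
have h : rjoin x y <= rjoin (x + z) (y + z) - z.
  by apply: rjoin_lub; [apply: (le_lin1 (rjoinl (x + z) (y + z)))
    |apply: (le_lin1 (rjoinr (x + z) (y + z)))]; lmod.
by apply: (le_lin1 h); lmod.
Qed.

Lemma rjoinZ (a : R) x y : 0 < a -> a *: rjoin x y = rjoin (a *: x) (a *: y).
Proof.
move=> a0; apply/eqP; rewrite eq_le; apply/andP; split; last first.
  by rewrite rjoin_le !vler_pZ// rjoinl rjoinr.
have b0 : 0 < a^-1 by rewrite invr_gt0.
rewrite -(vler_pZ _ _ b0) scalerA mulVf ?gt_eqF// scale1r.
by apply: rjoin_lub; rewrite -(vler_pZ _ _ a0) [leRHS]scalerA mulfV ?gt_eqF//
  scale1r ?rjoinl ?rjoinr.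
Qed.

Lemma rmeetZ (a : R) x y : 0 < a -> a *: rmeet x y = rmeet (a *: x) (a *: y).
Proof. by move=> a0; rewrite !rmeetE -rjoinZ//; lmod. Qed.

Lemma rpos_ge0 x : 0 <= rpos x. Proof. exact: rjoinr. Qed.
Lemma le_rpos x : x <= rpos x. Proof. exact: rjoinl. Qed.
Lemma rpos_le x y : 0 <= y -> x <= y -> rpos x <= y.
Proof. by move=> y0 xy; apply: rjoin_lub. Qed.
Lemma rpos_le2 x y : x <= y -> rpos x <= rpos y.
Proof. by move=> xy; apply: rjoin_le2. Qed.
Lemma rpos_id x : 0 <= x -> rpos x = x.
Proof. by move=> x0; apply/eqP; rewrite eq_le le_rpos rpos_le. Qed.
Lemma rpos0 x : x <= 0 -> rpos x = 0.
Proof. by move=> x0; apply/eqP; rewrite eq_le rpos_ge0 rpos_le. Qed.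
Lemma rpos_eq0 x : rpos x = 0 -> x <= 0.
Proof. by move=> <-; exact: le_rpos. Qed.

Lemma rposN x : rpos (- x) = rpos x - x.
Proof. by rewrite /rpos rjoinD subrr add0r rjoinC. Qed.

Lemma rposB x : rpos x - rpos (- x) = x.
Proof. by rewrite rposN; lmod. Qed.

Lemma rabsE x : rabs x = rpos x + rpos (- x).
Proof.
rewrite rposN; have -> : rpos x + (rpos x - x) = 2%:R *: rpos x - x by lmod.
rewrite /rpos rjoinZ ?ltr0n// rjoinD; congr rjoin; lmod.
Qed.

Lemma rabs_ge0 x : 0 <= rabs x.
Proof. by rewrite rabsE vaddr_ge0 ?rpos_ge0. Qed.
Lemma le_rabs x : x <= rabs x. Proof. exact: rjoinl. Qed.
Lemma leN_rabs x : - x <= rabs x. Proof. exact: rjoinr. Qed.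
Lemma rabs_le x y : x <= y -> - x <= y -> rabs x <= y.
Proof. exact: rjoin_lub. Qed.
Lemma rabs_id x : 0 <= x -> rabs x = x.
Proof.
move=> x0; apply/eqP; rewrite eq_le le_rabs rabs_le//.
by apply: (le_lin2 x0 x0); lmod.
Qed.
Lemma rabsN x : rabs (- x) = rabs x.
Proof. by rewrite /rabs opprK rjoinC. Qed.
Lemma rabs0 : rabs 0 = 0 :> V. Proof. exact: rabs_id. Qed.
Lemma rabs_eq0 x : rabs x = 0 -> x = 0.
Proof.
move=> h; apply/eqP; rewrite eq_le -{1}h le_rabs /=.
by rewrite -vleN oppr0 -h leN_rabs.
Qed.
Lemma rabsD x y : rabs (x + y) <= rabs x + rabs y.
Proof.
apply: rabs_le; first by apply: (le_lin2 (le_rabs x) (le_rabs y)); lmod.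
by apply: (le_lin2 (leN_rabs x) (leN_rabs y)); lmod.
Qed.
Lemma rabsZ (a : R) x : rabs (a *: x) = `|a| *: rabs x.
Proof.
wlog a0 : a / 0 <= a => [H|].
  have [/H//|/ltW a0] := leP 0 a.
  by rewrite -rabsN -scaleNr -normrN H ?oppr_ge0.
rewrite ger0_norm//; move: a0; rewrite le_eqVlt => /predU1P[<-|a0].
  by rewrite !scale0r rabs0.
by rewrite /rabs rjoinZ//; congr rjoin; lmod.
Qed.
Lemma rpos_le_rabs x : rpos x <= rabs x.
Proof. by apply: rpos_le; [exact: rabs_ge0|exact: le_rabs]. Qed.
Lemma rposD x y : rpos (x + y) <= rpos x + rpos y.
Proof.
apply: rpos_le; first by rewrite vaddr_ge0 ?rpos_ge0.
by apply: (le_lin2 (le_rpos x) (le_rpos y)); lmod.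
Qed.
Lemma rposZ (a : R) x : 0 <= a -> rpos (a *: x) = a *: rpos x.
Proof.
rewrite le_eqVlt => /predU1P[<-|a0]; first by rewrite !scale0r rpos_id.
by rewrite /rpos rjoinZ// scaler0.
Qed.

Lemma rmeet_ge0 x y : 0 <= x -> 0 <= y -> 0 <= rmeet x y.
Proof. exact: rmeet_glb. Qed.

Lemma rmeet_pos_neg x : rmeet (rpos x) (rpos (- x)) = 0.
Proof.
rewrite rmeetE; have -> : rjoin (rpos x) (rpos (- x)) = rabs x.
  apply/eqP; rewrite eq_le rjoin_le rpos_le_rabs -(rabsN x) rpos_le_rabs /=.
  rewrite rabsN rabs_le//; first exact: le_trans (le_rpos _) (rjoinl _ _).
  exact: le_trans (le_rpos _) (rjoinr _ _).
by rewrite rabsE; lmod.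
Qed.

Lemma rmeetDr x y z : 0 <= x -> 0 <= y -> 0 <= z ->
  rmeet x (y + z) <= rmeet x y + rmeet x z.
Proof.
move=> x0 y0 z0; set m := rmeet x (y + z).
have h1 : m - z <= rmeet x y.
  apply: rmeet_glb; last by apply: (le_lin1 (rmeetr x (y + z))); rewrite /m; lmod.
  by apply: (le_lin2 (rmeetl x (y + z)) z0); rewrite /m; lmod.
have h2 : m - rmeet x y <= rmeet x z.
  apply: rmeet_glb; last by apply: (le_lin1 h1); lmod.
  by apply: (le_lin2 (rmeetl x (y + z)) (rmeet_ge0 x0 y0)); rewrite /m; lmod.
by apply: (le_lin1 h2); lmod.
Qed.

(** * Disjointness *)

Lemma rdisjointC x y : rdisjoint x y -> rdisjoint y x.
Proof. by rewrite /rdisjoint rmeetC. Qed.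

Lemma rdisjointP x y : rmeet (rabs x) (rabs y) <= 0 -> rdisjoint x y.
Proof.
by move=> h; apply/eqP; rewrite eq_le h rmeet_ge0 ?rabs_ge0.
Qed.

Lemma rdisjoint_le x y z : rabs x <= rabs y -> rdisjoint y z -> rdisjoint x z.
Proof. by move=> xy yz; apply: rdisjointP; rewrite -yz rmeet_le2. Qed.

Lemma rdisjointD x y z : rdisjoint x z -> rdisjoint y z -> rdisjoint (x + y) z.
Proof.
move=> xz yz; apply: rdisjointP.
apply: (@le_trans _ _ (rmeet (rabs z) (rabs x + rabs y))).
  by rewrite rmeetC rmeet_le2 ?rabsD.
apply: (le_trans (rmeetDr _ _ _)); rewrite ?rabs_ge0//.
by rewrite rmeetC xz rmeetC yz addr0.
Qed.

Lemma rdisjointZ (a : R) x y : rdisjoint x y -> rdisjoint (a *: x) y.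
Proof.
move=> xy; apply: rdisjointP; rewrite rabsZ.
have a1 : 0 < 1 + `|a| by rewrite ltr_wpDr.
apply: (@le_trans _ _ ((1 + `|a|) *: rmeet (rabs x) (rabs y))); last first.
  by rewrite xy scaler0.
rewrite rmeetZ//; apply: rmeet_le2.
  by apply: (le_lin1 (rabs_ge0 x)); lmod.
by apply: (le_lin1 (vscale_ge0 (normr_ge0 a) (rabs_ge0 y))); lmod.
Qed.

Lemma rdisjoint0 x : rdisjoint 0 x.
Proof. by apply: rdisjointP; rewrite rabs0 rmeetl. Qed.

Lemma rdisjoint_self x : rdisjoint x x -> x = 0.
Proof.
rewrite /rdisjoint => h; apply: rabs_eq0; rewrite -[RHS]h.
by apply/esym/rmeet_idPl.
Qed.

(** For an upper bound [z] of [A] and [m] below both [rpos z] and [rabs c], the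
    part [rpos a] of each [a] in [A] is disjoint from [m], so that
    [rpos a + m] is a join and stays below [rpos z]; hence [z - m] is again an
    upper bound. *)
Lemma band_disjoint c : is_band [set x | rdisjoint x c].
Proof.
split; [split|].
- exact: rdisjoint0.
- by move=> a x y xc yc; apply: rdisjointD => //; exact: rdisjointZ.
- by move=> x y xc yx; exact: rdisjoint_le yx xc.
move=> A z Ac [zub zlub] /=.
have [[a0 Aa0]|A0] := pselect (A !=set0); last first.
  suff -> : c = 0 by exact/rdisjointC/rdisjoint0.
  apply: rabs_eq0; apply/eqP; rewrite eq_le rabs_ge0 andbT.
  have h : z <= z - rabs c by apply: zlub => x Ax; exfalso; apply: A0; exists x.
  by apply: (le_lin1 h); lmod.
have posc a : A a -> rdisjoint (rpos a) c.
  move=> /Ac; apply: rdisjoint_le.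
  by rewrite rabs_id ?rpos_ge0 ?rpos_le_rabs.
have negc : rdisjoint (rpos (- z)) c.
  apply: rdisjoint_le (Ac _ Aa0); rewrite rabs_id ?rpos_ge0// -(rabsN a0).
  apply: le_trans (rpos_le_rabs _); apply: rpos_le2; rewrite vleN; exact: zub.
suff posz : rdisjoint (rpos z) c.
  rewrite -(rposB z); apply: rdisjointD => //.
  by rewrite -scaleN1r; exact: rdisjointZ.
apply: rdisjointP; rewrite rabs_id ?rpos_ge0//.
set m := rmeet _ _.
have h : z <= z - m.
  apply: zlub => a Aa.
  have d : rmeet (rpos a) m = 0.
    apply/eqP; rewrite eq_le -{1}(posc a Aa) rabs_id ?rpos_ge0//.
    by rewrite rmeet_le2 ?rmeetr// !rmeet_ge0 ?rpos_ge0 ?rabs_ge0.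
  have j : rpos a + m <= rpos z.
    have -> : rpos a + m = rjoin (rpos a) m.
      by rewrite -[RHS]addr0 -d rmeetE; lmod.
    by apply: rjoin_lub; [apply: rpos_le2; exact: zub|exact: rmeetl].
  have n : rpos (- z) <= rpos (- a) by apply: rpos_le2; rewrite vleN; exact: zub.
  by apply: (le_lin2 j n); rewrite -{1}(rposB z) -[X in _ - X = _](rposB a); lmod.
by apply: (le_lin1 h); lmod.
Qed.

End RieszTheory.

(** * Inequalities on a band *)

Section LocalOrder.
Context {R : realType} {V : rieszType R}.
Implicit Types x y z u v w c d p q : V.

Definition le_on q x y := rdisjoint (rpos (x - y)) q.
Definition eq_on q x y := rdisjoint (x - y) q.

Lemma rdisjoint_ler p q x : 0 <= p -> p <= q -> rdisjoint x q -> rdisjoint x p.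
Proof.
move=> p0 pq /rdisjointC h; apply: rdisjointC; apply: rdisjoint_le h.
by rewrite !rabs_id// (le_trans p0).
Qed.

Lemma le_on_sub p q x y : 0 <= p -> p <= q -> le_on q x y -> le_on p x y.
Proof. exact: rdisjoint_ler. Qed.

Lemma eq_on_le q x y : eq_on q x y -> le_on q x y.
Proof.
by apply: rdisjoint_le; rewrite rabs_id ?rpos_ge0 ?rpos_le_rabs.
Qed.

Lemma eq_on_sym q x y : eq_on q x y -> eq_on q y x.
Proof. by apply: rdisjoint_le; rewrite -(rabsN (y - x)) opprB. Qed.

Lemma eq_on_ge q x y : eq_on q x y -> le_on q y x.
Proof. by move=> /eq_on_sym /eq_on_le. Qed.

Lemma le_onW q x y : x <= y -> le_on q x y.
Proof.
move=> xy; rewrite /le_on rpos0; first exact: rdisjoint0.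
by apply: (le_lin1 xy); lmod.
Qed.

Lemma le_on_lin1 q a b x y : le_on q a b -> y - x = b - a -> le_on q x y.
Proof.
by rewrite /le_on => h E; have -> // : x - y = a - b; rewrite -opprB E opprB.
Qed.

Lemma le_on_lin2 q a b c d x y : le_on q a b -> le_on q c d ->
  y - x = (b - a) + (d - c) -> le_on q x y.
Proof.
move=> ab cd E; apply: rdisjoint_le (rdisjointD ab cd).
rewrite !rabs_id ?vaddr_ge0 ?rpos_ge0//.
have -> : x - y = (a - b) + (c - d) by rewrite -opprB E; lmod.
exact: rposD.
Qed.

Lemma le_on_trans q x y z : le_on q x y -> le_on q y z -> le_on q x z.
Proof. by move=> xy yz; apply: (le_on_lin2 xy yz); lmod. Qed.

Lemma le_on_Z q (a : R) x y : 0 <= a -> le_on q x y -> le_on q (a *: x) (a *: y).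
Proof.
by move=> a0 h; rewrite /le_on -scalerBr rposZ//; exact: rdisjointZ.
Qed.

Lemma le_on_join q x y z : le_on q x z -> le_on q y z -> le_on q (rjoin x y) z.
Proof.
move=> xz yz; apply: rdisjoint_le (rdisjointD xz yz).
rewrite !rabs_id ?vaddr_ge0 ?rpos_ge0//.
rewrite rjoinD; apply: rpos_le; first by rewrite vaddr_ge0 ?rpos_ge0.
apply: rjoin_lub.
  by apply: (le_lin2 (le_rpos (x - z)) (rpos_ge0 (y - z))); lmod.
by apply: (le_lin2 (le_rpos (y - z)) (rpos_ge0 (x - z))); lmod.
Qed.

Lemma le_on_meet q x y z : le_on q z x -> le_on q z y -> le_on q z (rmeet x y).
Proof.
move=> zx zy; have h : le_on q (rjoin (- x) (- y)) (- z).
  by apply: le_on_join; [apply: (le_on_lin1 zx)|apply: (le_on_lin1 zy)]; lmod.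
have -> : rmeet x y = - rjoin (- x) (- y); last by apply: (le_on_lin1 h); lmod.
rewrite rmeetE; have -> : rjoin x y = rjoin (- x) (- y) + (x + y).
  by rewrite rjoinD rjoinC; congr rjoin; lmod.
by lmod.
Qed.

(** [rpos (y - x)] is disjoint from [rpos (x - y)]. *)
Lemma le_on_rposB q x y : 0 <= q -> q <= rpos (x - y) -> le_on q y x.
Proof.
move=> q0 qd; apply: rdisjoint_ler q0 qd _.
rewrite /rdisjoint !rabs_id ?rpos_ge0//.
by have := rmeet_pos_neg (y - x); rewrite opprB.
Qed.

Lemma le_on_total q x y : 0 < q ->
  le_on q x y \/ exists p, [/\ 0 < p, p <= q & p <= rpos (x - y)].
Proof.
move=> q0; pose p := rmeet (rpos (x - y)) q.
have p0 : 0 <= p by rewrite rmeet_ge0 ?rpos_ge0// ltW.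
have [pz|/eqP pn] := pselect (p = 0); last first.
  right; exists p; split; [|exact: rmeetr|exact: rmeetl].
  by rewrite lt_def pn.
by left; rewrite /le_on /rdisjoint !rabs_id ?rpos_ge0 ?(ltW q0).
Qed.

(** If [x <= y] failed on [q], it would fail on every [p > 0] below
    [rmeet (rpos (x - y)) q]. *)
Lemma le_on_local q x y : 0 <= q ->
  (forall q', 0 < q' -> q' <= q -> exists p, [/\ 0 < p, p <= q' & le_on p x y]) ->
  le_on q x y.
Proof.
rewrite le_eqVlt => /predU1P[<- _|q0 H].
  exact/rdisjointC/rdisjoint0.
have [//|[q' [q'0 q'q q'd]]] := le_on_total x y q0.
have [p [p0 pq ple]] := H _ q'0 q'q.
suff : p = 0 by move=> pz; move: p0; rewrite pz ltxx.
apply: rdisjoint_self; apply: rdisjoint_le ple.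
by rewrite !rabs_id ?rpos_ge0 ?(ltW p0)// (le_trans pq).
Qed.

Lemma le_global x y :
  (forall q, 0 < q -> exists p, [/\ 0 < p, p <= q & le_on p x y]) -> x <= y.
Proof.
move=> H; suff : rpos (x - y) = 0.
  by move=> /rpos_eq0 h; apply: (le_lin1 h); lmod.
by apply: rdisjoint_self; apply: le_on_local => [|q q0 _]; [exact: rpos_ge0|exact: H].
Qed.

(** The supremum of [A] cannot exceed [u] on [q]: its excess [m] over [u] there
    could be subtracted from it. *)
Lemma sup_le_on q A z u : 0 <= q -> supremums A z ->
  (forall x, A x -> le_on q x u) -> le_on q z u.
Proof.
move=> q0 [zub zlub] H; pose m := rmeet (rpos (z - u)) q.
have m0 : 0 <= m by rewrite rmeet_ge0 ?rpos_ge0.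
suff : m <= 0.
  by move=> h; apply: rdisjointP; rewrite !rabs_id ?rpos_ge0.
have : z <= z - m; last by move=> h; apply: (le_lin1 h); lmod.
apply: zlub => x Ax; apply: le_global => q1 q10.
have [mz|[p [p0 pq1]]] := le_on_total m 0 q10.
  exists q1; split => //.
  by apply: (le_on_lin2 (le_onW q1 (zub _ Ax)) mz); lmod.
rewrite subr0 rpos_id// => pm; exists p; split => //.
have xu : le_on p x u.
  by apply: le_on_sub (H _ Ax); rewrite ?(ltW p0)// (le_trans pm) ?rmeetr.
have uz : le_on p u z.
  by apply: le_on_rposB; rewrite ?(ltW p0)// (le_trans pm) ?rmeetl.
have mzu : le_on p m (z - u).
  apply: le_on_trans (le_onW p (rmeetl _ _)) _; apply: le_on_join.
    exact: le_onW.
  by apply: (le_on_lin1 uz); lmod.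
by apply: (le_on_lin2 xu mzu); lmod.
Qed.

End LocalOrder.

(** * Suprema and band projections *)

Section DedekindComplete.
Context {R : realType} {V : rieszType R}.
Implicit Types x y z u v w c d p q e : V.
Implicit Types A : set V.

Context (hV : dedekind_complete [set: V]).

Lemma sup_exists A b : A !=set0 -> ubound A b -> exists z, supremums A z.
Proof.
move=> A0 Ab; have [||z [_ zub zlub]] := hV (A := A) _ A0; first by [].
  by exists b.
by exists z; split => // w ?; exact: zlub.
Qed.

Lemma supremums_uniq A x y : supremums A x -> supremums A y -> x = y.
Proof. by move=> [xu xl] [yu yl]; apply/eqP; rewrite eq_le xl// yl. Qed.

Lemma supremumE A z : supremums A z -> supremum 0 A = z.
Proof.
move=> Az; rewrite /supremum; case: ifPn => [/eqP A0|A0].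
  move: Az; rewrite A0 => -[_ zl].
  have h w : z <= w by apply: zl.
  have h2 : z <= z + z by [].
  apply/eqP; rewrite eq_le h andbT.
  by apply: (le_lin1 h2); lmod.
by apply: (supremums_uniq _ Az); apply: xgetPex; exists z.
Qed.

(** If [s] is the supremum of the multiples of [x], then [s - x] bounds them too. *)
Lemma archimedean e x : (forall n : nat, n%:R *: x <= e) -> x <= 0.
Proof.
move=> H; have [||s [sub slub]] := @sup_exists (range (fun n : nat => n%:R *: x)) e.
- by exists (0%:R *: x), 0%N.
- by move=> _ [n _ <-].
have : s <= s - x; last by move=> h; apply: (le_lin1 h); lmod.
apply: slub => _ [n _ <-].
have h : n.+1%:R *: x <= s by apply: sub; exists n.+1.
by apply: (le_lin1 h); rewrite -natr1; lmod.
Qed.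

Lemma archimedean_eps e x :
  (forall eps : R, 0 < eps -> x <= eps *: e) -> x <= 0.
Proof.
move=> H; have e0 : 0 <= rpos e := rpos_ge0 e.
apply: (@archimedean (rpos e)) => -[|n]; first by rewrite scale0r.
have n0 : 0 < n.+1%:R :> R by rewrite ltr0n.
have i0 : 0 < n.+1%:R^-1 :> R by rewrite invr_gt0.
rewrite -(vler_pZ _ _ i0) scalerA mulVf ?gt_eqF// scale1r.
apply: le_trans (H _ i0) _; apply: vler_wZ (le_rpos _); exact: ltW.
Qed.

Lemma le_on_eps q e x y : 0 <= q -> 0 <= e ->
  (forall eps : R, 0 < eps -> le_on q x (y + eps *: e)) -> le_on q x y.
Proof.
move=> q0 e0 H; apply: rdisjointP; apply: (@archimedean_eps e) => eps eps0.
rewrite !rabs_id ?rpos_ge0//.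
have ee0 : 0 <= eps *: e by rewrite vscale_ge0// ltW.
have h : rpos (x - y) <= rpos (x - (y + eps *: e)) + eps *: e.
  rewrite -{2}(rpos_id ee0); apply: le_trans (rposD _ _).
  by rewrite rpos_le2// le_eqVlt; apply/orP; left; apply/eqP; lmod.
apply: (@le_trans _ _ (rmeet q (rpos (x - (y + eps *: e)) + eps *: e))).
  by rewrite rmeetC rmeet_le2.
apply: le_trans (rmeetDr _ _ _) _ => //; first exact: rpos_ge0.
have := H _ eps0; rewrite /le_on /rdisjoint !rabs_id ?rpos_ge0// rmeetC => ->.
by rewrite add0r rmeetr.
Qed.

Lemma band_of_self d : band_of d d.
Proof. by move=> B [_]; apply. Qed.

Lemma band_of_band d : is_band (band_of d).
Proof.
split; [split|].
- by move=> B [[[]]].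
- move=> a x y Bx By B hB; have [[[_ h _] _] _] := hB.
  apply: h; [exact: (Bx B hB)|exact: (By B hB)].
- move=> x y Bx yx B hB; have [[[_ _ h] _] _] := hB.
  by apply: h yx; exact: (Bx B hB).
- move=> A z AB Az B hB; have [[_ h] _] := hB.
  by apply: h Az => x /AB Bx; exact: (Bx B hB).
Qed.

Lemma band_of_le d x : rabs x <= rabs d -> band_of d x.
Proof.
by move=> xd; have [[_ _ h] _] := band_of_band d; apply: h xd; exact: band_of_self.
Qed.

Lemma band_of_disjoint d p x : rdisjoint d p -> band_of d x -> rdisjoint x p.
Proof.
move=> dp Bx; apply: (Bx [set x | rdisjoint x p]); split.
  exact: band_disjoint.
by move=> _ ->.
Qed.

(** The component is the supremum [b] of the elements of the band below [x]: an
    element of the band below [x - b] could be added to [b]. *)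
Lemma band_proj_exists_pos d x : 0 <= x ->
  exists b, band_of d b /\ forall c, band_of d c -> rdisjoint (x - b) c.
Proof.
move=> x0; have [[B0 Blin Bsolid] Bsup] := band_of_band d.
pose A := [set b | band_of d b /\ b <= x].
have [||b Ab] := @sup_exists A x.
- by exists 0.
- by move=> b [].
have Bb : band_of d b by apply: (Bsup A) => // z [].
have bx : b <= x by apply: Ab.2 => z [].
exists b; split=> // c Bc; apply: rdisjointP.
rewrite [rabs (x - b)]rabs_id ?vsubr_ge0//; set m := rmeet _ _.
have m0 : 0 <= m by rewrite rmeet_ge0 ?vsubr_ge0 ?rabs_ge0.
have Bm : band_of d m.
  by apply: (Bsolid c) => //; rewrite rabs_id// rmeetr.
have h : b + m <= b.
  apply: Ab.1; split; first by rewrite addrC -[m]scale1r; exact: Blin.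
  by apply: (le_lin1 (rmeetl (x - b) (rabs c))); rewrite /m; lmod.
by apply: (le_lin1 h); lmod.
Qed.

Lemma band_projP d x : band_of d (band_proj d x) /\
  forall c, band_of d c -> rdisjoint (x - band_proj d x) c.
Proof.
apply: (xgetPex 0 (P := [set b | band_of d b /\ forall c, band_of d c -> rdisjoint (x - b) c])).
have [[B0 Blin Bsolid] Bsup] := band_of_band d.
have [b1 [Bb1 h1]] := band_proj_exists_pos d (rpos_ge0 x).
have [b2 [Bb2 h2]] := band_proj_exists_pos d (rpos_ge0 (- x)).
exists (b1 - b2); split.
  by rewrite addrC -scaleN1r; exact: Blin.
move=> c Bc.
have -> : x - (b1 - b2) = (rpos x - b1) + (-1) *: (rpos (- x) - b2).
  by rewrite -{1}(rposB x); lmod.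
by apply: rdisjointD; [exact: h1|apply: rdisjointZ; exact: h2].
Qed.

Lemma band_proj_off d p x : rdisjoint d p -> eq_on p (band_proj d x) 0.
Proof.
by move=> dp; rewrite /eq_on subr0; apply: band_of_disjoint dp (band_projP d x).1.
Qed.

Lemma band_proj_on d p x : 0 <= p -> p <= rabs d -> eq_on p (band_proj d x) x.
Proof.
move=> p0 pd; apply: eq_on_sym; apply: (band_projP d x).2.
by apply: band_of_le; rewrite rabs_id.
Qed.

(** Either [y <= t] on [q], and then [q] is disjoint from [rpos (y - t)]; or some
    [p] below [q] lies below [rpos (y - t)], hence in its band. *)
Lemma band_proj_cases q y t : 0 < q -> exists p, [/\ 0 < p, p <= q &
  (le_on p y t /\ forall x, eq_on p (band_proj (rpos (y - t)) x) 0) \/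
  (le_on p t y /\ forall x, eq_on p (band_proj (rpos (y - t)) x) x)].
Proof.
move=> q0; have [h|[p [p0 pq pd]]] := le_on_total y t q0.
  by exists q; split => //; left; split => // x; exact: band_proj_off.
exists p; split => //; right; split; first by apply: le_on_rposB => //; exact: ltW.
by move=> x; apply: band_proj_on; rewrite ?(ltW p0)// rabs_id ?rpos_ge0.
Qed.

End DedekindComplete.

(** * Local comparison with the unit *)

Section UnitSpace.
Context {R : realType} {V : rieszType R}.
Implicit Types x y z u v w c d p q : V.
Context (hV : dedekind_complete [set: V]).
Context (hL : @laterally_complete R V).
Context (e : V) (e_ge0 : 0 <= e) (e_unit : forall q, rdisjoint e q -> q = 0).

Lemma le_on_unit q (a b : R) : 0 < q -> le_on q (a *: e) (b *: e) -> a <= b.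
Proof.
move=> q0 h; rewrite leNgt; apply/negP => ba.
have ab0 : 0 < a - b by rewrite subr_gt0.
suff qz : q = 0 by move: q0; rewrite qz ltxx.
apply: e_unit; apply: rdisjoint_le (rdisjointZ (a - b)^-1 h).
rewrite -scalerBl rposZ ?(ltW ab0)// scalerA mulVf ?gt_eqF// scale1r.
by rewrite rpos_id.
Qed.

(** If [n *: e <= x] held on [q] for all [n], then [rmeet e q] would be
    infinitely small compared with [rpos x]. *)
Lemma locally_bounded q x : 0 < q ->
  exists p (n : nat), [/\ 0 < p, p <= q & le_on p x (n%:R *: e)].
Proof.
move=> q0; apply: contrapT => H.
have q_ge0 := ltW q0.
suff qz : q = 0 by move: q0; rewrite qz ltxx.
apply: e_unit; apply: rdisjointP; rewrite !rabs_id//.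
apply: (@archimedean _ _ hV (rpos x)) => n; apply: le_global => q1 q10.
have nx : le_on q (n%:R *: e) x.
  have [//|[p [p0 pq pd]]] := le_on_total (n%:R *: e) x q0.
  exfalso; apply: H; exists p, n; split => //.
  by apply: le_on_rposB => //; exact: ltW.
have m0 : 0 <= rmeet e q by exact: rmeet_ge0.
have [mz|[p [p0 pq1]]] := le_on_total (rmeet e q) 0 q10.
  exists q1; split => //; have h := le_on_Z (ler0n R n) mz.
  by apply: (le_on_lin2 h (le_onW q1 (rpos_ge0 x))); lmod.
rewrite subr0 rpos_id// => pm; exists p; split => //.
have nx' : le_on p (n%:R *: e) (rpos x).
  apply: le_on_trans (le_onW p (le_rpos x)); apply: le_on_sub nx.
    exact: ltW.
  exact: le_trans pm (rmeetr _ _).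
by apply: le_on_trans nx'; apply: le_onW; rewrite vler_wZ ?rmeetl.
Qed.

(** The least [n] with [x <= theta n *: e] on some part of [q]; the strict form
    [p <= rpos (x - theta n.-1 *: e)] of the lower bound is what makes the
    spectral component at [theta n.-1] equal to [e] on [p]. *)
Lemma locally_between (theta : nat -> R) q x : 0 < q ->
  (forall M, exists n, M <= theta n) ->
  exists p n, [/\ 0 < p, p <= q, le_on p x (theta n *: e) &
    n = 0%N \/ p <= rpos (x - theta n.-1 *: e)].
Proof.
move=> q0 theta_unb; have [q1 [k [q10 q1q xk]]] := locally_bounded x q0.
have [n kn] := theta_unb k%:R.
have {}xk : le_on q1 x (theta n *: e).
  apply: le_on_trans xk (le_onW _ _); have kn0 : 0 <= theta n - k%:R.
    by rewrite subr_ge0.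
  by apply: (le_lin1 (vscale_ge0 kn0 e_ge0)); lmod.
elim: n xk {kn} => [|n IH] xn; first by exists q1, 0%N; split => //; left.
have [/IH//|[p [p0 pq1 pd]]] := le_on_total x (theta n *: e) q10.
exists p, n.+1; split => //; first exact: le_trans pq1 q1q.
  by apply: le_on_sub xn => //; exact: ltW.
by right.
Qed.

(** * The spectral system *)

Lemma spectral_cases q y t : 0 < q -> exists p, [/\ 0 < p, p <= q &
  (le_on p y (t *: e) /\ eq_on p (spectral e y t) 0) \/
  (le_on p (t *: e) y /\ eq_on p (spectral e y t) e)].
Proof.
move=> q0; have [p [p0 pq H]] := band_proj_cases hV y (t *: e) q0.
by exists p; split => //; case: H => -[? H]; [left|right]; split => //; exact: H.
Qed.

Lemma spectral_below q y t : le_on q y (t *: e) -> eq_on q (spectral e y t) 0.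
Proof. exact: band_proj_off. Qed.

Lemma spectral_above p y t : 0 <= p -> p <= rpos (y - t *: e) ->
  eq_on p (spectral e y t) e.
Proof.
by move=> p0 pd; apply: band_proj_on => //; rewrite rabs_id ?rpos_ge0.
Qed.

Lemma spectral_gt q y (t t' : R) : 0 <= q -> t < t' -> le_on q (t' *: e) y ->
  le_on q e (spectral e y t).
Proof.
move=> q0 tt' ty; apply: le_on_local => // q' q'0 q'q.
have [p [p0 pq' H]] := spectral_cases y t q'0.
exists p; split => //; case: H => -[yt h]; last exact: eq_on_ge.
have : le_on p (t' *: e) (t *: e).
  apply: le_on_trans yt; apply: le_on_sub ty; first exact: ltW.
  exact: le_trans pq' q'q.
by move=> /(le_on_unit p0); rewrite leNgt tt'.
Qed.

Lemma spectral_ge0 y t : 0 <= spectral e y t.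
Proof.
apply: le_global => q q0; have [p [p0 pq H]] := spectral_cases y t q0.
exists p; split => //; case: H => -[_ h]; first exact: eq_on_ge.
by apply: le_on_trans (eq_on_ge h); exact: le_onW.
Qed.

Lemma spectral_le y t : spectral e y t <= e.
Proof.
apply: le_global => q q0; have [p [p0 pq H]] := spectral_cases y t q0.
exists p; split => //; case: H => -[_ h]; last exact: eq_on_le.
by apply: le_on_trans (eq_on_le h) _; exact: le_onW.
Qed.

Lemma spectral_anti y (s t : R) : s <= t -> spectral e y t <= spectral e y s.
Proof.
move=> st; apply: le_global => q q0.
have [p [p0 pq H]] := spectral_cases y s q0; exists p; split => //.
case: H => -[ys h].
  apply: le_on_trans (eq_on_ge h); apply: eq_on_le; apply: spectral_below.
  apply: le_on_trans ys (le_onW _ _).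
  have st0 : 0 <= t - s by rewrite subr_ge0.
  by apply: (le_lin1 (vscale_ge0 st0 e_ge0)); lmod.
by apply: le_on_trans (eq_on_ge h); apply: le_onW; exact: spectral_le.
Qed.

(** * Powers *)

(** The set in the definition of [rpow e y r]. *)
Definition power_steps y (r : R) := [set z | exists a b c : R,
    [/\ a < b, 0 <= c,
        forall t, 0 <= t -> a < t -> t <= b -> c <= t `^ r
      & z = c *: (spectral e y a - spectral e y b)]].

Lemma power_step_le_on q y z (r s : R) : 0 <= q -> 0 <= y -> 0 <= r -> 0 <= s ->
  le_on q y (s *: e) -> power_steps y r z -> le_on q z (s `^ r *: e).
Proof.
move=> q0 y0 r0 s0 ys [a [b [c [ab c0 hc ->]]]].
apply: le_on_local => // q1 q10 q1q.
have ysq1 : le_on q1 y (s *: e) by apply: le_on_sub ys => //; exact: ltW.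
have sr0 : 0 <= s `^ r *: e by rewrite vscale_ge0 ?powR_ge0.
have sb0 := spectral_ge0 y b.
have [sa|a_s] := leP s a.
  exists q1; split => //; apply: le_on_trans (le_onW _ sr0).
  have h : le_on q1 (spectral e y a) 0.
    apply: eq_on_le; apply: spectral_below; apply: le_on_trans ysq1 (le_onW _ _).
    have as0 : 0 <= a - s by rewrite subr_ge0.
    by apply: (le_lin1 (vscale_ge0 as0 e_ge0)); lmod.
  have h2 := le_on_Z c0 h.
  by apply: (le_on_lin2 h2 (le_onW _ (vscale_ge0 c0 sb0))); lmod.
have [p [p0 pq1 H]] := spectral_cases y b q10; exists p; split => //.
have sae := spectral_le y a.
case: H => -[yb h].
  have b0 : 0 <= b.
    apply: (le_on_unit p0); rewrite scale0r.
    by apply: le_on_trans yb; exact: le_onW.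
  have cs : c <= s `^ r.
    (* the hypothesis on [c] is used at a point of ]a, b] that is at most [s] *)
    have h0 : 0 <= Num.min s b by rewrite le_min s0.
    apply: (@le_trans _ _ (Num.min s b `^ r)).
      by apply: hc; rewrite ?lt_min ?a_s ?ab ?ge_min ?lexx ?orbT.
    by apply: ge0_ler_powR => //; rewrite ?nnegrE// ge_min lexx.
  have h2 := le_on_Z c0 (eq_on_ge h).
  have h3 : le_on p (c *: spectral e y a) (s `^ r *: e).
    apply: le_onW; apply: (@le_trans _ _ (c *: e)); first exact: vler_wZ.
    have cs0 : 0 <= s `^ r - c by rewrite subr_ge0.
    by apply: (le_lin1 (vscale_ge0 cs0 e_ge0)); lmod.
  by apply: (le_on_lin2 h2 h3); lmod.
apply: le_on_trans (le_onW _ sr0).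
have h2 := le_on_Z c0 (eq_on_ge h); have h3 := vler_wZ c0 sae.
by apply: (le_on_lin2 h2 (le_onW _ h3)); lmod.
Qed.

(** [y] need not be bounded, so neither are the steps by a multiple of [e]; they
    are bounded by the join, provided by lateral completeness, of the disjoint
    elements equal to [n%:R `^ r] on the component where [n - 1 < y <= n]. *)
Lemma power_steps_sup y (r : R) : 0 <= y -> 0 < r ->
  exists w, supremums (power_steps y r) w.
Proof.
move=> y0 r0.
pose x (n : nat) := n%:R `^ r *: (spectral e y (n%:R - 1) - spectral e y n%:R).
have x0 n : 0 <= x n.
  by rewrite vscale_ge0 ?powR_ge0// vsubr_ge0 spectral_anti// lerBlDr lerDl.
have xdisj m n : (m < n)%N -> rdisjoint (x m) (x n).
  move=> mn; apply: rdisjointP; rewrite !rabs_id//; apply: le_global => q q0.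
  have mn1 : m%:R <= n%:R - 1 :> R by rewrite lerBrDr natr1 ler_nat.
  have xz k p : le_on p (spectral e y (k%:R - 1)) (spectral e y k%:R) ->
      le_on p (x k) 0.
    by move=> h; apply: (le_on_lin1 (le_on_Z (powR_ge0 k%:R r) h)); rewrite /x; lmod.
  have [ym|[p [p0 pq pd]]] := le_on_total y (m%:R *: e) q0.
    exists q; split => //; apply: le_on_trans (le_onW _ (rmeetr _ _)) _.
    apply: xz; apply: le_on_trans (le_onW _ (spectral_ge0 _ _)).
    apply: eq_on_le; apply: spectral_below; apply: le_on_trans ym (le_onW _ _).
    have d0 : 0 <= n%:R - 1 - m%:R :> R by rewrite subr_ge0.
    by apply: (le_lin1 (vscale_ge0 d0 e_ge0)); lmod.
  exists p; split => //; apply: le_on_trans (le_onW _ (rmeetl _ _)) _.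
  apply: xz; apply: le_on_trans (le_onW _ (spectral_le _ _)) _.
  by apply: eq_on_ge; apply: spectral_above => //; exact: ltW.
have [||_ _ [m _ <-] [n _ <-] mn|w [wub _]] := hL (A := range x).
- by exists (x 0%N), 0%N.
- by move=> _ [n _ <-].
- have [/xdisj//|/xdisj /rdisjointC//|mneq] := ltngtP m n.
  by case: mn; rewrite mneq.
apply: (sup_exists hV (b := w)).
  exists (0 *: (spectral e y 0 - spectral e y 1)), 0, 1, 0; split => // t t0 _ _.
  exact: powR_ge0.
move=> z zs; apply: le_global => q q0.
have [|p [n [p0 pq yn H]]] := @locally_between (fun n => n%:R) q y q0.
  by move=> M; exists (Num.truncn M).+1; exact/ltW/truncnS_gt.
exists p; split => //.
apply: le_on_trans (power_step_le_on (ltW p0) y0 (ltW r0) (ler0n _ _) yn zs) _.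
case: H => [->|pd].
  rewrite powR0 ?gt_eqF// scale0r; apply: le_onW.
  by apply: le_trans (x0 0%N) (wub _ _); exists 0%N.
case: n yn pd => [|n] yn pd.
  rewrite powR0 ?gt_eqF// scale0r; apply: le_onW.
  by apply: le_trans (x0 0%N) (wub _ _); exists 0%N.
have xw : x n.+1 <= w by apply: wub; exists n.+1.
apply: le_on_trans (le_onW p xw).
have E : n.+1%:R - 1 = n%:R :> R by rewrite -natr1 addrK.
have h1 : le_on p e (spectral e y n%:R).
  by apply: eq_on_ge; apply: spectral_above => //; exact: ltW.
have h2 := eq_on_le (spectral_below yn).
have h3 := le_on_Z (powR_ge0 n.+1%:R r) h1.
have h4 := le_on_Z (powR_ge0 n.+1%:R r) h2.
by apply: (le_on_lin2 h3 h4); rewrite /x E; lmod.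
Qed.

Lemma rpow_sup y (r : R) : 0 <= y -> 0 < r -> supremums (power_steps y r) (rpow e y r).
Proof.
move=> y0 r0; have [w hw] := power_steps_sup y0 r0.
by rewrite /rpow /fcalc (supremumE hw).
Qed.

Lemma rpow_ge0 y (r : R) : 0 <= y -> 0 < r -> 0 <= rpow e y r.
Proof.
move=> y0 r0; apply: (rpow_sup y0 r0).1.
exists 0, 1, 0; split => //; last by rewrite scale0r.
by move=> t *; exact: powR_ge0.
Qed.

Lemma rpow_le_on q y (r b : R) : 0 <= q -> 0 <= y -> 0 < r -> 0 <= b ->
  le_on q y (b *: e) -> le_on q (rpow e y r) (b `^ r *: e).
Proof.
move=> q0 y0 r0 b0 yb; apply: (sup_le_on q0 (rpow_sup y0 r0)) => z.
by apply: power_step_le_on => //; exact: ltW.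
Qed.

Lemma powRVK (r t : R) : r != 0 -> 0 <= t -> (t `^ r^-1) `^ r = t.
Proof. by move=> r0 t0; rewrite -powRrM mulVf// powRr1. Qed.

Lemma powRKV (r t : R) : r != 0 -> 0 <= t -> (t `^ r) `^ r^-1 = t.
Proof. by move=> r0 t0; rewrite -powRrM mulfV// powRr1. Qed.

(** A step between [a'] and a local bound of [y] has the value [a' `^ r] for
    every [a' < a]; choosing [a'] with [a' `^ r = a `^ r - eps] avoids any appeal
    to continuity. *)
Lemma rpow_ge_on q y (r a : R) : 0 <= q -> 0 <= y -> 0 < r -> 0 <= a ->
  le_on q (a *: e) y -> le_on q (a `^ r *: e) (rpow e y r).
Proof.
move=> q0 y0 r0 a0 ay; apply: (le_on_eps hV (e := e)) => // eps eps0.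
have yr0 := rpow_ge0 y0 r0.
have [are|ear] := leP (a `^ r) eps.
  apply: le_onW; have d0 : 0 <= eps - a `^ r by rewrite subr_ge0.
  by apply: (le_lin2 yr0 (vscale_ge0 d0 e_ge0)); lmod.
have are0 : 0 <= a `^ r - eps by rewrite subr_ge0 ltW.
pose a' := (a `^ r - eps) `^ r^-1.
have Ea' : a' `^ r = a `^ r - eps by rewrite powRVK// gt_eqF.
have a'0 : 0 <= a' by exact: powR_ge0.
have a'a : a' < a.
  rewrite ltNge; apply/negP => /(ge0_ler_powR (ltW r0)); rewrite !nnegrE.
  by move=> /(_ a0 a'0); rewrite Ea' lerBrDr gerDl leNgt eps0.
apply: le_on_local => // q1 q10 q1q.
have [p [n [p0 pq1 yn]]] := locally_bounded y q10; exists p; split => //.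
have pq := le_trans pq1 q1q.
pose b := n%:R + a.
have yb : le_on p y (b *: e).
  by apply: (le_on_lin2 yn (le_onW p (vscale_ge0 a0 e_ge0))); rewrite /b; lmod.
have s : power_steps y r (a' `^ r *: (spectral e y a' - spectral e y b)).
  exists a', b, (a' `^ r); split => //; last first.
  - move=> t t0 /ltW a't _; apply: ge0_ler_powR; rewrite ?nnegrE//.
    exact: ltW.
  - exact: powR_ge0.
  - by rewrite /b ltr_wpDl.
have h1 := (rpow_sup y0 r0).1 _ s.
have h2 := le_on_Z (powR_ge0 a' r) (spectral_gt (ltW p0) a'a (le_on_sub (ltW p0) pq ay)).
have h3 := le_on_Z (powR_ge0 a' r) (eq_on_le (spectral_below yb)).
have h4 : le_on p (a' `^ r *: e) (a' `^ r *: (spectral e y a' - spectral e y b)).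
  by apply: (le_on_lin2 h2 h3); lmod.
by apply: (le_on_lin1 (le_on_trans h4 (le_onW p h1))); rewrite Ea'; lmod.
Qed.

Lemma le_unit (a b : R) : a <= b -> a *: e <= b *: e.
Proof.
rewrite -subr_ge0 => ab; by apply: (le_lin1 (vscale_ge0 ab e_ge0)); lmod.
Qed.

(** The thresholds [theta n] are chosen with equally spaced [r]-th powers
    [n%:R * eta]. *)
Lemma power_grid q y (r eta : R) : 0 < q -> 0 <= y -> 0 < r -> 0 < eta ->
  exists p a b, [/\ 0 < p, p <= q, 0 <= a /\ 0 <= b,
    le_on p (a *: e) y /\ le_on p y (b *: e) & b `^ r <= a `^ r + eta].
Proof.
move=> q0 y0 r0 eta0; pose theta (n : nat) := (n%:R * eta) `^ r^-1.
have rn0 : r != 0 by rewrite gt_eqF.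
have ne0 (n : nat) : 0 <= n%:R * eta by rewrite mulr_ge0// ltW.
have theta_ge0 n : 0 <= theta n by exact: powR_ge0.
have Etheta n : theta n `^ r = n%:R * eta by rewrite powRVK.
have [M|p [n [p0 pq yn H]]] := @locally_between theta q y q0.
  have [n Mn] : exists n : nat, `|M| `^ r <= n%:R * eta.
    exists (Num.truncn (`|M| `^ r / eta)).+1.
    by rewrite -ler_pdivrMr//; exact/ltW/truncnS_gt.
  exists n; apply: le_trans (ler_norm M) _.
  rewrite -(@powRKV r `|M|)//; apply: ge0_ler_powR => //.
  - by rewrite invr_ge0 ltW.
  - by rewrite nnegrE powR_ge0.
  - by rewrite nnegrE.
case: n yn H => [|n] yn H.
  exists p, 0, (theta 0%N); split => //; last first.
    by rewrite Etheta mul0r powR0// add0r ltW.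
  by split => //; apply: le_onW; rewrite scale0r.
exists p, (theta n), (theta n.+1); split => //.
  by split => //; case: H => // pd; apply: le_on_rposB => //; exact: ltW.
by rewrite !Etheta -natr1 mulrDl mul1r.
Qed.

(** The enclosures of [power_grid] reduce monotonicity to that of the real power:
    where [a <= y <= b], [x <= b] and [b `^ r <= a `^ r + eta]. *)
Lemma le_rpow_on q x y (r : R) : 0 <= q -> 0 <= x -> 0 <= y -> 0 < r ->
  le_on q x y -> le_on q (rpow e x r) (rpow e y r).
Proof.
move=> q0 x0 y0 r0 xy; apply: (le_on_eps hV (e := e)) => // eta eta0.
apply: le_on_local => // q1 q10 q1q.
have [p [a [b [p0 pq1 [a0 b0] [ay yb] ab]]]] := power_grid q10 y0 r0 eta0.
exists p; split => //.
have xb : le_on p x (b *: e).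
  by apply: le_on_trans yb; apply: le_on_sub xy;
    rewrite ?(ltW p0)// (le_trans pq1).
have h1 := rpow_le_on (ltW p0) x0 r0 b0 xb.
have h2 := rpow_ge_on (ltW p0) y0 r0 a0 ay.
apply: le_on_trans h1 (le_on_trans (le_onW p (le_unit ab)) _).
by apply: (le_on_lin1 h2); lmod.
Qed.

Lemma rpow_scale_le y (l r : R) : 0 <= y -> 0 < l -> 0 < r ->
  rpow e (l *: y) r <= l `^ r *: rpow e y r.
Proof.
move=> y0 l0 r0; apply: le_global => q q0; exists q; split => //.
apply: (le_on_eps hV (e := e)) => //; first exact: ltW.
move=> eta eta0; apply: le_on_local; first exact: ltW.
move=> q1 q10 q1q; have lr0 : 0 < l `^ r by rewrite powR_gt0.
have eta'0 : 0 < eta / l `^ r by rewrite divr_gt0.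
have [p [a [b [p0 pq1 [a0 b0] [ay yb] ab]]]] := power_grid q10 y0 r0 eta'0.
exists p; split => //.
have ly0 : 0 <= l *: y by rewrite vscale_ge0// ltW.
have lb : le_on p (l *: y) ((l * b) *: e).
  by rewrite -scalerA; apply: le_on_Z => //; exact: ltW.
have h1 := rpow_le_on (ltW p0) ly0 r0 (mulr_ge0 (ltW l0) b0) lb.
have h2 := le_on_Z (ltW lr0) (rpow_ge_on (ltW p0) y0 r0 a0 ay).
apply: le_on_trans h1 _; rewrite powRM ?(ltW l0)//.
have h3 : l `^ r * b `^ r <= l `^ r * a `^ r + eta.
  have := ler_wpM2l (ltW lr0) ab.
  by rewrite mulrDr (mulrC _ (eta / _)) divfK ?gt_eqF.
apply: le_on_trans (le_onW p (le_unit h3)) _.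
by apply: (le_on_lin1 h2); lmod.
Qed.

(** Where [rabs x <= rabs y], [rabs (x + y) <= 2 *: rabs y]; so the left-hand side
    is bounded there by the second term alone, and symmetrically. *)
Lemma rpow_add_le x y (r : R) : 0 < r ->
  rpow e (rabs (x + y)) r <= 2 `^ r *: (rpow e (rabs x) r + rpow e (rabs y) r).
Proof.
move=> r0; apply: le_global => q q0.
have hx u := rpow_ge0 (rabs_ge0 u) r0.
have key p u v : 0 < p -> le_on p (rabs u) (rabs v) ->
    le_on p (rpow e (rabs (u + v)) r) (2 `^ r *: rpow e (rabs v) r).
  move=> p0 uv; apply: (@le_on_trans _ _ _ _ (rpow e (2 *: rabs v) r)).
    have v0 : 0 <= 2 *: rabs v by rewrite vscale_ge0// rabs_ge0.
    apply: le_rpow_on => //; rewrite ?(ltW p0) ?rabs_ge0//.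
    by apply: (le_on_lin2 (le_onW p (rabsD u v)) uv); lmod.
  by apply: le_onW; apply: rpow_scale_le; rewrite ?rabs_ge0.
have tr0 : 0 <= 2 `^ r :> R by exact: powR_ge0.
have [xy|[p [p0 pq pd]]] := le_on_total (rabs x) (rabs y) q0.
  exists q; split => //; apply: (le_on_lin2 (key q x y q0 xy)
    (le_onW _ (vscale_ge0 tr0 (hx x)))); lmod.
exists p; split => //; have yx := le_on_rposB (ltW p0) pd.
have -> : x + y = y + x by lmod.
apply: (le_on_lin2 (key p y x p0 yx)
    (le_onW _ (vscale_ge0 tr0 (hx y)))); lmod.
Qed.

End UnitSpace.

(** * Estimates for powers and roots *)

Section PowerEstimates.
Context {R : realType} {V : rieszType R}.
Implicit Types x y z u v w p q g h G : V.
Context (hV : dedekind_complete [set: V]).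
Context (hL : @laterally_complete R V).
Context (e : V) (e_ge0 : 0 <= e) (e_unit : forall q, rdisjoint e q -> q = 0).
Context (r : R) (r_ge1 : 1 <= r).

Let r_gt0 : 0 < r. Proof. exact: lt_le_trans r_ge1. Qed.
Let rV_gt0 : 0 < r^-1. Proof. by rewrite invr_gt0. Qed.
Let r_neq0 : r != 0. Proof. by rewrite gt_eqF. Qed.

Let pow_ge_on := rpow_ge_on hV hL e_ge0 e_unit.
Let pow_le_on := rpow_le_on hV hL e_ge0 e_unit.
Let pow_ge0 := rpow_ge0 hV hL e_ge0 e_unit.
Let grid := power_grid hV e_ge0 e_unit.

Lemma powR_predM (t : R) : 0 <= t -> t `^ r = t * t `^ (r - 1).
Proof.
move=> t0; have := @powRD _ t 1 (r - 1); rewrite subrKC powRr1// => -> //.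
by rewrite (gt_eqF r_gt0).
Qed.

(** If [s = a `^ r^-1 > delta], then [a = s * s `^ (r - 1) >= s * delta `^ (r - 1)]. *)
Lemma powRV_le_affine (delta a : R) : 0 < delta -> 0 <= a ->
  a `^ r^-1 <= delta + delta `^ (1 - r) * a.
Proof.
move=> d0 a0; have dp : 0 < delta `^ (1 - r) by exact: powR_gt0.
have [h|h] := leP (a `^ r^-1) delta.
  by apply: (le_trans h); rewrite lerDl mulr_ge0// ltW.
apply: (@le_trans _ _ (delta `^ (1 - r) * a)); last by rewrite lerDr ltW.
have s0 : 0 <= a `^ r^-1 by exact: powR_ge0.
rewrite -{2}(powRVK r_neq0 a0) powR_predM// mulrCA ler_peMr//.
apply: (@le_trans _ _ (delta `^ (1 - r) * delta `^ (r - 1))).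
  rewrite -powRD; last by apply/implyP => _; rewrite gt_eqF.
  have -> : 1 - r + (r - 1) = 0 by ring.
  by rewrite powRr0.
by apply: ler_wpM2l; [exact: ltW|apply: ge0_ler_powR; rewrite ?nnegrE ?subr_ge0// ltW].
Qed.

Lemma rpow_root_le z (delta : R) : 0 <= z -> 0 < delta ->
  rpow e z r^-1 <= delta *: e + delta `^ (1 - r) *: z.
Proof.
move=> z0 d0; apply: le_global => q q0; exists q; split => //.
apply: (le_on_eps hV (e := e)) => //; first exact: ltW.
move=> eta eta0; apply: le_on_local => [|q1 q10 q1q]; first exact: ltW.
have [p [a [b [p0 pq1 [a0 b0] [az zb] ab]]]] := grid q10 z0 rV_gt0 eta0.
exists p; split => //.
have h1 := pow_le_on (ltW p0) z0 rV_gt0 b0 zb.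
have h2 : b `^ r^-1 <= delta + delta `^ (1 - r) * a + eta.
  by apply: (le_trans ab); rewrite lerD2r powRV_le_affine.
apply: le_on_trans h1 (le_on_trans (le_onW p (le_unit e_ge0 h2)) _).
have h3 := le_on_Z (powR_ge0 delta (1 - r)) az.
by apply: (le_on_lin1 h3); lmod.
Qed.

Lemma le_of_root_le z v : 0 <= z -> 0 <= v -> rpow e z r^-1 <= v -> z <= rpow e v r.
Proof.
move=> z0 v0 zv; apply: le_global => q q0; exists q; split => //.
apply: (le_on_eps hV (e := e)) => //; first exact: ltW.
move=> eta eta0; apply: le_on_local => [|q1 q10 q1q]; first exact: ltW.
have [p [a [b [p0 pq1 [a0 b0] [az zb] ab]]]] := grid q10 z0 ltr01 eta0.
exists p; split => //; move: ab; rewrite !powRr1// => ab.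
have h1 := pow_ge_on (ltW p0) z0 rV_gt0 a0 az.
have h2 := le_on_trans h1 (le_onW p zv).
have h3 := pow_ge_on (ltW p0) v0 r_gt0 (powR_ge0 _ _) h2.
rewrite powRVK// in h3.
apply: le_on_trans zb (le_on_trans (le_onW p (le_unit e_ge0 ab)) _).
by apply: (le_on_lin1 h3); lmod.
Qed.

(** Where [z <= K `^ r] the first term dominates; elsewhere [w >= z] exceeds
    [K `^ r], so that [w] is at most twice its excess over [K `^ r / 2]. *)
Lemma le_root_cut z w (K : R) : 0 <= z -> z <= w -> 0 < K ->
  z <= K `^ (r - 1) *: rpow e z r^-1 + 2 *: rpos (w - (K `^ r / 2) *: e).
Proof.
move=> z0 zw K0; apply: le_global => q q0.
have K1 : 0 <= K `^ (r - 1) by exact: powR_ge0.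
have cut0 : 0 <= 2 *: rpos (w - (K `^ r / 2) *: e).
  by rewrite vscale_ge0// rpos_ge0.
have [zK|[q1 [q10 q1q qd]]] := le_on_total z (K `^ r *: e) q0; last first.
  exists q1; split => //; have Kz := le_on_rposB (ltW q10) qd.
  have h1 := vler_wZ (ler0n R 2) (le_rpos (w - (K `^ r / 2) *: e)).
  have h2 := le_on_trans Kz (le_onW q1 zw).
  have h3 := vscale_ge0 K1 (pow_ge0 z0 rV_gt0).
  have h4 : le_on q1 w (2 *: rpos (w - (K `^ r / 2) *: e)).
    by apply: (le_on_lin2 (le_onW q1 h1) h2); lmod_coef; field.
  apply: le_on_trans (le_onW q1 zw) _.
  by apply: (le_on_lin2 h4 (le_onW q1 h3)); lmod.
exists q; split => //.
apply: (le_on_eps hV (e := e)) => //; first exact: ltW.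
move=> eta eta0; apply: le_on_local => [|q1 q10 q1q]; first exact: ltW.
have [p [a [b [p0 pq1 [a0 b0] [az zb] ab]]]] := grid q10 z0 ltr01 eta0.
exists p; split => //; move: ab; rewrite !powRr1// => ab.
have aK : a <= K `^ r.
  apply: (le_on_unit e_ge0 e_unit p0); apply: le_on_trans az _.
  by apply: le_on_sub zK; rewrite ?(ltW p0)// (le_trans pq1).
have h1 := le_on_Z K1 (pow_ge_on (ltW p0) z0 rV_gt0 a0 az).
have h2 : a <= K `^ (r - 1) * a `^ r^-1.
  rewrite -{1}(powRVK r_neq0 a0) powR_predM ?powR_ge0// mulrC ler_wpM2r ?powR_ge0//.
  apply: ge0_ler_powR; rewrite ?nnegrE ?powR_ge0 ?subr_ge0 ?(ltW K0)//.
  rewrite -(powRKV r_neq0 (ltW K0)).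
  by apply: ge0_ler_powR; rewrite ?nnegrE ?powR_ge0// ltW.
have h3 : b <= K `^ (r - 1) * a `^ r^-1 + eta by apply: (le_trans ab); rewrite lerD2r.
apply: le_on_trans zb (le_on_trans (le_onW p (le_unit e_ge0 h3)) _).
by apply: (le_on_lin2 h1 (le_onW p cut0)); lmod.
Qed.

(** * Truncations by spectral components *)

Local Notation above y t := (band_proj (rpos (y - t *: e))).

Lemma above_bounds y t x : 0 <= x -> 0 <= above y t x <= x.
Proof.
move=> x0; apply/andP; split; apply: le_global => q q0;
  have [p [p0 pq H]] := band_proj_cases hV y (t *: e) q0; exists p; split => //;
  case: H => -[_ /(_ x) h].
- exact: eq_on_ge.
- by apply: le_on_trans (eq_on_ge h); exact: le_onW.
- by apply: le_on_trans (eq_on_le h) _; exact: le_onW.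
- exact: eq_on_le.
Qed.

Lemma le_add_above y (c : R) : 0 <= c -> y <= c *: e + above y c y.
Proof.
move=> c0; apply: le_global => q q0; have ce0 := vscale_ge0 c0 e_ge0.
have [p [p0 pq H]] := band_proj_cases hV y (c *: e) q0; exists p; split => //.
case: H => -[yc /(_ y) E].
  by apply: (le_on_lin2 yc (eq_on_ge E)); lmod.
by apply: (le_on_lin2 (eq_on_ge E) (le_onW p ce0)); lmod.
Qed.

Lemma chebyshev_rpow h (eps : R) : 0 < eps ->
  eps `^ r *: above (rabs h) eps e <= rpow e (rabs h) r.
Proof.
move=> eps0; apply: le_global => q q0.
have h0 := rabs_ge0 h.
have [p [p0 pq H]] := band_proj_cases hV (rabs h) (eps *: e) q0.
exists p; split => //; case: H => -[yt /(_ e) E].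
  apply: le_on_trans (le_on_Z (powR_ge0 eps r) (eq_on_le E)) _.
  by rewrite scaler0; apply: le_onW; exact: pow_ge0.
apply: le_on_trans (le_on_Z (powR_ge0 eps r) (eq_on_le E)) _.
by apply: pow_ge_on; rewrite ?(ltW p0) ?(ltW eps0).
Qed.

Lemma above_le_cut y (t : R) : above y t y <= 2 *: rpos (y - (t / 2) *: e).
Proof.
apply: le_global => q q0.
have [p [p0 pq H]] := band_proj_cases hV y (t *: e) q0.
exists p; split => //; case: H => -[yt /(_ y) E].
  apply: le_on_trans (eq_on_le E) (le_onW _ _).
  by rewrite vscale_ge0// rpos_ge0.
apply: le_on_trans (eq_on_le E) _.
have h := vler_wZ (ler0n R 2) (le_rpos (y - (t / 2) *: e)).
by apply: (le_on_lin2 (le_onW p h) yt); lmod_coef; field.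
Qed.

(** Used with [y = |f_ n|^r], [g = |f_ n - f|^r] and [G = |f|^r] to make the tails
    of [y] uniformly small: split [G] at [k]; where [c < y], the constant [k] is at
    most [(k / c) *: y]. *)
Lemma above_le_split y g G (A c k : R) : 0 <= A -> 0 < c -> 0 <= k ->
  0 <= y -> 0 <= g -> y <= A *: (g + G) ->
  above y c y <= A *: g + (A * (k / c)) *: y + A *: rpos (G - k *: e).
Proof.
move=> A0 c0 k0 y0 g0 yA; apply: le_global => q q0.
have Akc : 0 <= A * (k / c) by rewrite mulr_ge0// divr_ge0// ltW.
have r0 := rpos_ge0 (G - k *: e).
have [p [p0 pq H]] := band_proj_cases hV y (c *: e) q0.
exists p; split => //; case: H => -[yt /(_ y) E].
  apply: le_on_trans (eq_on_le E) (le_onW _ _).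
  by rewrite !vaddr_ge0// vscale_ge0.
apply: le_on_trans (eq_on_le E) _.
have h1 := le_on_Z Akc yt.
have h2 := vler_wZ A0 (le_rpos (G - k *: e)).
have h3 : le_on p y (y + (A * (k / c)) *: y + A *: rpos (G - k *: e) - A *: G).
  by apply: (le_on_lin2 h1 (le_onW p h2)); lmod_coef; field; rewrite gt_eqF.
by apply: (le_on_lin2 h3 (le_onW p yA)); lmod.
Qed.

(** Where [rabs h <= eps] the first term suffices. Elsewhere both [y] and [G] are
    split at [c], and the constants are carried by the component of [e] where
    [eps < rabs h]. *)
Lemma rpow_le_split h y G (A c eps : R) : 0 <= A -> 0 <= c -> 0 <= eps -> 0 <= y ->
  rpow e (rabs h) r <= A *: (y + G) ->
  rpow e (rabs h) r <= eps `^ r *: e +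
    A *: ((2 * c) *: above (rabs h) eps e + above y c y + rpos (G - c *: e)).
Proof.
move=> A0 c0 eps0 y0 hA; apply: le_global => q q0.
have ph := above_bounds (rabs h) eps e_ge0.
have py := above_bounds y c y0.
have r0 := rpos_ge0 (G - c *: e).
have h0 := rabs_ge0 h.
have c20 : 0 <= 2 * c by rewrite mulr_ge0.
have epse : 0 <= eps `^ r *: e by rewrite vscale_ge0// powR_ge0.
have [q1 [q10 q1q [[ht E]|[ht E]]]] := band_proj_cases hV (rabs h) (eps *: e) q0.
  exists q1; split => //; have := pow_le_on (ltW q10) h0 r_gt0 eps0 ht.
  move=> /le_on_trans; apply; apply: le_onW.
  have : 0 <= A *: ((2 * c) *: above (rabs h) eps e + above y c y + rpos (G - c *: e)).
    rewrite vscale_ge0// !vaddr_ge0//; last by case/andP: py.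
    by apply: vscale_ge0 => //; case/andP: ph.
  by move=> h1; apply: (le_lin1 h1); lmod.
exists q1; split => //.
have ee := le_on_Z c20 (eq_on_ge (E e)).
have gc := le_rpos (G - c *: e).
have h1 : le_on q1 (y + G)
    ((2 * c) *: above (rabs h) eps e + above y c y + rpos (G - c *: e)).
  have h2 : y + G <= c *: e + above y c y + rpos (G - c *: e) + c *: e.
    by apply: (le_lin2 (le_add_above y c0) gc); lmod.
  by apply: (le_on_lin2 (le_onW q1 h2) ee); lmod.
apply: le_on_trans (le_onW q1 hA) _.
by apply: (le_on_lin2 (le_on_Z A0 h1) (le_onW q1 epse)); lmod.
Qed.

(** The estimate behind Fatou's lemma: the truncation at [k] confines the part
    where [eps < rabs h] to [k] times a component of the unit. *)
Lemma trunc_le_split h y G (A k eps : R) : 0 <= A -> 0 <= k -> 0 <= eps -> 0 <= y ->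
  G <= A *: (y + rpow e (rabs h) r) ->
  rmeet G (k *: e) <= A *: y + (A * eps `^ r) *: e + k *: above (rabs h) eps e.
Proof.
move=> A0 k0 eps0 y0 GA; apply: le_global => q q0.
have [ph _] := andP (above_bounds (rabs h) eps e_ge0).
have h0 := rabs_ge0 h.
have Ay := vscale_ge0 A0 y0.
have Ae : 0 <= (A * eps `^ r) *: e by rewrite vscale_ge0// mulr_ge0// powR_ge0.
have [p [p0 pq [[ht E]|[ht E]]]] := band_proj_cases hV (rabs h) (eps *: e) q0;
  exists p; split => //.
  apply: le_on_trans (le_onW p (le_trans (rmeetl _ _) GA)) _.
  have h1 := le_on_Z A0 (pow_le_on (ltW p0) h0 r_gt0 eps0 ht).
  by apply: (le_on_lin2 h1 (le_onW p (vscale_ge0 k0 ph))); lmod.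
apply: le_on_trans (le_onW p (rmeetr _ _)) _.
apply: (le_on_lin2 (le_on_Z k0 (eq_on_ge (E e))) (le_onW p (vaddr_ge0 Ay Ae))).
lmod.
Qed.

Lemma meet_unit_sup y : 0 <= y -> supremums [set rmeet y (k%:R *: e) | k in [set: nat]] y.
Proof.
move=> y0; split => [_ [k _ <-]|w wub]; first exact: rmeetl.
apply: le_global => q q0; have [p [n [p0 pq yn]]] := locally_bounded hV e_ge0 e_unit y q0.
exists p; split => //.
apply: le_on_trans (le_on_meet (le_onW p (lexx y)) yn) (le_onW p _).
by apply: wub; exists n.
Qed.

End PowerEstimates.

(** * The embedding in the universal completion *)

Section Embedding.
Context {R : realType} {E Eu : rieszType R}.
Context (iota : {linear E -> Eu}) (hEu : universal_completion iota).
Implicit Types (a b c : E) (x y z u v w : Eu).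

Lemma iota_le a b : (iota a <= iota b) = (a <= b).
Proof.
apply/idP/idP => [/rmeet_idPl h|/rmeet_idPl h]; apply/rmeet_idPl.
  by apply: (uc_inj hEu); rewrite (uc_meet hEu).
by rewrite -(uc_meet hEu) h.
Qed.

Lemma iota_ge0 a : (0 <= iota a) = (0 <= a).
Proof. by rewrite -iota_le linear0. Qed.

(** An upper bound [w] of the images which is not above [iota z] would leave
    room for some [iota x > 0] below [rpos (iota z - w)], and [z - x] would still
    bound the set. *)
Lemma iota_sup (A : set E) (z : E) : supremums A z -> supremums (iota @` A) (iota z).
Proof.
move=> [zub zlub]; split => [_ [a Aa <-]|w wub]; first by rewrite iota_le zub.
apply: contrapT => zw; set u := rpos (iota z - w).
have u0 : 0 < u.
  rewrite lt_def rpos_ge0 andbT; apply/eqP => /rpos_eq0 h; apply: zw.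
  by apply: (le_lin1 h); lmod.
have [x /andP[x0 xu]] := uc_order_dense hEu u0.
have h : z <= z - x.
  apply: zlub => a Aa; rewrite -iota_le raddfB /=.
  have h1 : iota a <= w by apply: wub; exists a.
  have h2 : iota a <= iota z by rewrite iota_le zub.
  have h3 : u <= iota z - iota a.
    apply: rpos_le; first by rewrite vsubr_ge0.
    by apply: (le_lin1 h1); lmod.
  by apply: (le_lin2 h3 xu); lmod.
have : iota x <= 0.
  by rewrite -(linear0 iota) iota_le; apply: (le_lin1 h); lmod.
by move=> /(lt_le_trans x0); rewrite ltxx.
Qed.

Definition below x : set E := [set a | 0 <= a /\ iota a <= x].

(** If a bound [w] were not above [x], some [iota a > 0] would fit below
    [rpos (x - w)]; adding [a] to a member of [below x] gives a member again, so
    all multiples of [iota a] would lie below [x]. *)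
Lemma below_sup x : 0 <= x -> supremums (iota @` below x) x.
Proof.
move=> x0; split => [_ [a [_ ax] <-]//|w wub].
apply: contrapT => xw; set u := rpos (x - w).
have u0 : 0 < u.
  rewrite lt_def rpos_ge0 andbT; apply/eqP => /rpos_eq0 h; apply: xw.
  by apply: (le_lin1 h); lmod.
have [a /andP[a0 au]] := uc_order_dense hEu u0.
have step b : below x b -> below x (b + a).
  move=> [b0 bx]; have a_ge0 : 0 <= a by rewrite -iota_ge0 ltW.
  split; first exact: vaddr_ge0.
  rewrite raddfD /=; have h1 : iota b <= w by apply: wub; exists b.
  have h3 : u <= x - iota b.
    apply: rpos_le; first by rewrite vsubr_ge0.
    by apply: (le_lin1 h1); lmod.
  by apply: (le_lin2 h3 au); lmod.
have multiples (n : nat) : below x (n%:R *: a).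
  elim: n => [|n IH]; first by rewrite scale0r; split; rewrite ?linear0.
  have -> : n.+1%:R *: a = n%:R *: a + a by rewrite -natr1; lmod.
  exact: step.
have : iota a <= 0.
  apply: (@archimedean _ _ (uc_complete hEu) x) => n.
  by rewrite -linearZ; exact: (multiples n).2.
by move=> /(lt_le_trans a0); rewrite ltxx.
Qed.

Definition approximates (A : set E) x :=
  [/\ A !=set0, forall a, A a -> 0 <= a,
      forall a b, A a -> A b -> exists c, [/\ A c, a <= c & b <= c]
    & supremums (iota @` A) x].

Lemma approximates_below x : 0 <= x -> approximates (below x) x.
Proof.
move=> x0; split.
- by exists 0; split; rewrite ?linear0.
- by move=> a [].
- move=> a b [a0 ax] [b0 bx]; exists (rjoin a b); split; rewrite ?rjoinl ?rjoinr//.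
  split; first exact: le_trans a0 (rjoinl _ _).
  by rewrite (uc_join hEu) rjoin_lub.
- exact: below_sup.
Qed.

Lemma approximates_ge0 A x : approximates A x -> 0 <= x.
Proof.
move=> [[a Aa] A0 _ [xub _]]; apply: (@le_trans _ _ (iota a)).
  by rewrite iota_ge0 A0.
by apply: xub; exists a.
Qed.

Lemma approximates_bounded A x a : approximates A x -> A a -> below x a.
Proof.
by move=> [_ A0 _ [xub _]] Aa; split; [exact: A0|apply: xub; exists a].
Qed.

Lemma directed_approximates A x : approximates A x ->
  directed (fun s t : {a | A a} => sval s <= sval t).
Proof.
move=> [[a Aa] _ dir _]; split.
- by exists; exists a.
- by move=> s /=.
- by move=> s t u; exact: le_trans.
- move=> [s As] [t At]; have [c [Ac sc tc]] := dir _ _ As At.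
  by exists (exist _ c Ac).
Qed.

End Embedding.

(** * The extension of the conditional expectation *)

Section Extension.
Context {R : realType} {E Eu : rieszType R}.
Context (e : E) (T : {linear E -> E}) (hT : conditional_riesz_triple e T).
Context (iota : {linear E -> Eu}) (hEu : universal_completion iota).
Implicit Types (a b c : E) (x y z u v w : Eu) (A : set E).

Let ce := crt_ce hT.
Let hEuc : dedekind_complete [set: Eu] := uc_complete hEu.
Local Notation below := (below iota).
Local Notation approximates := (approximates iota).
Local Notation iotaT := (fun a => iota (T a)).

Lemma T_ge0 a : 0 <= a -> 0 <= T a.
Proof.
rewrite le_eqVlt => /predU1P[<-|a0]; first by rewrite linear0.
by rewrite ltW// (ce_strictly_positive ce).
Qed.

Lemma T_le a b : a <= b -> T a <= T b.
Proof. by rewrite -vsubr_ge0 => /T_ge0; rewrite raddfB vsubr_ge0. Qed.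

(** The meets of [a] with the members of [A] increase to [a], so order
    continuity makes their images increase to [T a]. *)
Lemma T_below_approx A x a w : approximates A x -> below x a ->
  ubound (iotaT @` A) w -> iota (T a) <= w.
Proof.
move=> hA [a0 ax] wub; have [_ _ _ [xub xlub]] := hA.
pose leA := fun s t : {a | A a} => sval s <= sval t.
pose m (s : {a | A a}) := rmeet a (sval s).
have dir : directed leA := directed_approximates hA.
have m_sup b : (forall s, m s <= b) -> a <= b.
  move=> mb; rewrite -(iota_le hEu).
  have : x <= iota b + x - iota a; last by move=> h; apply: (le_lin1 h); lmod.
  apply: xlub => _ [c Ac <-].
  have h1 := mb (exist _ c Ac); rewrite -(iota_le hEu) (uc_meet hEu) in h1.
  have h2 : iota c <= x by apply: xub; exists c.
  have h3 : rjoin (iota a) (iota c) <= x by exact: rjoin_lub.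
  have h4 := rmeetE (iota a) (iota c).
  by rewrite h4 /= in h1; apply: (le_lin2 h1 h3); lmod.
have cvg_m : order_cvg setT leA m a.
  exists _, leA, (fun s => a - m s); split => //.
  - move=> s t st; have h := rmeet_le2 (lexx a) st.
    by apply: (le_lin1 h); lmod.
  - split=> //; split=> //.
      by move=> _ [s _ <-]; rewrite vsubr_ge0 rmeetl.
    move=> b _ bub; have h : a <= a - b; last by apply: (le_lin1 h); lmod.
    apply: m_sup => s; have h : b <= a - m s by apply: bub; exists s.
    by apply: (le_lin1 h); lmod.
  - move=> s; exists s => t st; rewrite -rabsN opprB rabs_id ?vsubr_ge0 ?rmeetl//.
    have h := rmeet_le2 (lexx a) st.
    by apply: (le_lin1 h); lmod.
have [J [leJ [v [dJ vdec [_ [_ vlb vinf]] vbound]]]] :=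
  ce_order_continuous ce dir cvg_m.
have Tm_sup : supremums (range (T \o m)) (T a).
  split => [_ [s _ <-]|b bub]; first exact/T_le/rmeetl.
  have h : T a - b <= 0; last by apply: (le_lin1 h); lmod.
  apply: vinf => // _ [j _ <-]; have [s0 hs0] := vbound j.
  have [_ refl _ _] := dir; have h1 := hs0 _ (refl s0).
  have h2 := le_trans (leN_rabs _) h1.
  have h3 : (T \o m) s0 <= b by apply: bub; exists s0.
  by apply: (le_lin2 h2 h3); lmod.
have [_] := iota_sup hEu Tm_sup; apply => _ [_ [[c Ac] _ <-] <-].
apply: (@le_trans _ _ (iota (T c))); last by apply: wub; exists c.
by rewrite (iota_le hEu) T_le// rmeetr.
Qed.

(** [nat_dom_pos] and the extension of [T], read off the largest approximating set
    instead of an arbitrary net; see [nat_dom_posP] and [ext_posP]. *)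
Definition in_dom x := 0 <= x /\ exists w, ubound (iotaT @` below x) w.
Definition Tpos x := supremum 0 (iotaT @` below x).

Lemma Tpos_sup x : in_dom x -> supremums (iotaT @` below x) (Tpos x).
Proof.
move=> [x0 [w wub]]; have [|z hz] := sup_exists hEuc _ wub.
  by exists (iota (T 0)), 0 => //; split; rewrite ?linear0.
by rewrite /Tpos (supremumE hz).
Qed.

Lemma approximates_dom A x w : approximates A x -> ubound (iotaT @` A) w ->
  in_dom x.
Proof.
move=> hA wub; split; first exact: (approximates_ge0 hEu hA).
by exists w => _ [a ax <-]; exact: T_below_approx hA ax wub.
Qed.

Lemma Tpos_approx A x : approximates A x -> in_dom x ->
  supremums (iotaT @` A) (Tpos x).
Proof.
move=> hA hx; have [zub zlub] := Tpos_sup hx; split.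
  by move=> _ [a Aa <-]; apply: zub; exists a => //; exact: approximates_bounded hA Aa.
by move=> w wub; apply: zlub => _ [a ax <-]; exact: T_below_approx hA ax wub.
Qed.

Lemma Tpos_ge0 x : in_dom x -> 0 <= Tpos x.
Proof.
move=> hx; have [h _] := Tpos_sup hx; apply: h.
by exists 0; rewrite ?linear0//; split; rewrite ?linear0//; case: hx.
Qed.

Lemma in_dom_le x y : 0 <= x -> x <= y -> in_dom y -> in_dom x.
Proof.
move=> x0 xy [y0 [w wub]]; split => //; exists w => _ [a [a0 ax] <-].
by apply: wub; exists a => //; split => //; exact: le_trans xy.
Qed.

Lemma Tpos_le x y : 0 <= x -> x <= y -> in_dom y -> Tpos x <= Tpos y.
Proof.
move=> x0 xy hy; have [_ h] := Tpos_sup (in_dom_le x0 xy hy).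
apply: h => _ [a [a0 ax] <-]; have [h _] := Tpos_sup hy.
by apply: h; exists a => //; split => //; exact: le_trans xy.
Qed.

Lemma sup_add (X Y Z : set Eu) x y : supremums X x -> supremums Y y ->
  (forall u v, X u -> Y v -> exists2 z, Z z & u + v <= z) ->
  (forall z, Z z -> z <= x + y) -> supremums Z (x + y).
Proof.
move=> [xub xlub] [yub ylub] hle hge; split => // w wub.
have h : y <= w - x; last by apply: (le_lin1 h); lmod.
apply: ylub => b Yb; have h : x <= w - b; last by apply: (le_lin1 h); lmod.
apply: xlub => a Xa; have [c Zc abc] := hle _ _ Xa Yb.
by apply: (le_lin1 (le_trans abc (wub _ Zc))); lmod.
Qed.

Definition sum_set A1 A2 : set E := [set a + b | a in A1 & b in A2].

Lemma approximatesD A1 A2 x y : approximates A1 x -> approximates A2 y ->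
  approximates (sum_set A1 A2) (x + y).
Proof.
move=> hA1 hA2; have [[a1 Aa1] A10 dir1 s1] := hA1.
have [[a2 Aa2] A20 dir2 s2] := hA2; split.
- by exists (a1 + a2), a1 => //; exists a2.
- by move=> _ [a Aa [b Ab <-]]; apply: vaddr_ge0; [exact: A10|exact: A20].
- move=> _ _ [a Aa [b Ab <-]] [c Ac [d Ad <-]].
  have [f [Af af cf]] := dir1 _ _ Aa Ac; have [g [Ag bg dg]] := dir2 _ _ Ab Ad.
  exists (f + g); split; first by exists f => //; exists g.
    by apply: (le_lin2 af bg); lmod.
  by apply: (le_lin2 cf dg); lmod.
- apply: (sup_add s1 s2) => [_ _ [a Aa <-] [b Ab <-]|_ [_ [a Aa [b Ab <-]] <-]].
    by exists (iota a + iota b) => //; exists (a + b); rewrite ?raddfD//; exists a => //; exists b.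
  have h1 : iota a <= x by apply: s1.1; exists a.
  have h2 : iota b <= y by apply: s2.1; exists b.
  by rewrite raddfD; apply: (le_lin2 h1 h2); lmod.
Qed.

(** The sums of members of [below x] and [below y] approximate [x + y]. *)
Lemma TposD x y : in_dom x -> in_dom y ->
  in_dom (x + y) /\ Tpos (x + y) = Tpos x + Tpos y.
Proof.
move=> hx hy; have [x0 _] := hx; have [y0 _] := hy.
have hA := approximatesD (approximates_below hEu x0) (approximates_below hEu y0).
have s : supremums (iotaT @` sum_set (below x) (below y)) (Tpos x + Tpos y).
  apply: (sup_add (Tpos_sup hx) (Tpos_sup hy)).
    move=> _ _ [a Aa <-] [b Ab <-]; exists (iota (T a) + iota (T b)) => //.
    by exists (a + b); rewrite ?raddfD//; exists a => //; exists b.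
  move=> _ [_ [a Aa [b Ab <-]] <-].
  have h1 : iota (T a) <= Tpos x by apply: (Tpos_sup hx).1; exists a.
  have h2 : iota (T b) <= Tpos y by apply: (Tpos_sup hy).1; exists b.
  by rewrite !raddfD; apply: (le_lin2 h1 h2); lmod.
have hxy := approximates_dom hA s.1; split => //.
exact: supremums_uniq (Tpos_approx hA hxy) s.
Qed.

Lemma TposZ (k : R) x : 0 <= k -> in_dom x ->
  in_dom (k *: x) /\ Tpos (k *: x) = k *: Tpos x.
Proof.
rewrite le_eqVlt => /predU1P[<- hx|k0 hx].
  have h0 : in_dom 0 by case: (hx) => x0 _; exact: in_dom_le hx.
  rewrite !scale0r; split => //.
  have [_ h] := TposD h0 h0; rewrite addr0 in h.
  by apply: (addrI (Tpos 0)); rewrite -h addr0.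
have [x0 _] := hx; have [zub zlub] := Tpos_sup hx.
have kx0 : 0 <= k *: x by rewrite vscale_ge0 ?(ltW k0).
have kK y : k *: (k^-1 *: y) = y by rewrite scalerA mulfV ?gt_eqF// scale1r.
have kK' a : k *: (k^-1 *: a) = a by rewrite scalerA mulfV ?gt_eqF// scale1r.
have bZ a : below (k *: x) a -> below x (k^-1 *: a).
  move=> [a0 akx]; split; first by rewrite vscale_ge0// invr_ge0 ltW.
  by rewrite linearZ /= -(vler_pZ _ _ k0) kK.
have s : supremums (iotaT @` below (k *: x)) (k *: Tpos x).
  split.
    move=> _ [a ha <-]; rewrite -[a]kK' !linearZ /= vler_pZ//.
    by have := zub _ (imageP _ (bZ _ ha)); rewrite !linearZ.
  move=> w wub; rewrite -[w]kK vler_pZ//; apply: zlub => _ [a [a0 ax] <-].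
  rewrite -(vler_pZ _ _ k0) kK; apply: wub; exists (k *: a).
    by split; [rewrite vscale_ge0 ?(ltW k0)|rewrite linearZ vler_wZ ?(ltW k0)].
  by rewrite !linearZ.
have hkx : in_dom (k *: x) by split => //; exists (k *: Tpos x); exact: s.1.
by split => //; exact: supremums_uniq (Tpos_sup hkx) s.
Qed.

(** Monotone convergence: the sets [below x] for [x] in an upward directed [X]
    unite to a directed set approximating the supremum of [X]. *)
Section MonotoneConvergence.
Context (X : set Eu) (s : Eu) (hX : X !=set0) (X_ge0 : forall x, X x -> in_dom x).
Context (X_dir : forall x y, X x -> X y -> exists z, [/\ X z, x <= z & y <= z]).
Context (X_sup : supremums X s).

Let A : set E := [set a | exists2 x, X x & below x a].

Let hA : approximates A s.
Proof.
have [x1 X1] := hX; split.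
- by exists 0, x1 => //; split; rewrite ?linear0//; case: (X_ge0 X1).
- by move=> a [x _ []].
- move=> a b [x Xx [a0 ax]] [y Xy [b0 yb]]; have [z [Xz xz yz]] := X_dir Xx Xy.
  exists (rjoin a b); split; rewrite ?rjoinl ?rjoinr//; exists z => //.
  split; first exact: le_trans a0 (rjoinl _ _).
  by rewrite (uc_join hEu) rjoin_lub//; [exact: le_trans xz|exact: le_trans yz].
- split => [_ [a [x Xx [_ ax]] <-]|w wub]; first exact: le_trans ax (X_sup.1 _ Xx).
  apply: X_sup.2 => x Xx; have [x0 _] := X_ge0 Xx.
  apply: (below_sup hEu x0).2 => _ [a ha <-]; apply: wub; exists a => //.
  by exists x.
Qed.

Lemma Tpos_bounded_dom w : (forall x, X x -> Tpos x <= w) -> in_dom s.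
Proof.
move=> h; apply: (approximates_dom hA (w := w)) => _ [a [x Xx ha] <-].
by apply: le_trans (h _ Xx); apply: (Tpos_sup (X_ge0 Xx)).1; exists a.
Qed.

Lemma Tpos_monotone : in_dom s -> supremums (Tpos @` X) (Tpos s).
Proof.
move=> hs; have [zub zlub] := Tpos_approx hA hs; split.
  move=> _ [x Xx <-]; have [x0 _] := X_ge0 Xx.
  by apply: Tpos_le hs => //; exact: X_sup.1.
move=> w wub; apply: zlub => _ [a [x Xx ha] <-].
apply: le_trans (wub _ (imageP _ Xx)).
by apply: (Tpos_sup (X_ge0 Xx)).1; exists a.
Qed.

End MonotoneConvergence.

(** * The natural domain *)

Lemma approx_netP (I : Type) (leI : I -> I -> Prop) (a : I -> E) x :
  approx_net iota T leI a x -> approximates (range a) x /\ in_dom x.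
Proof.
move=> [[[i0] _ _ dir] a0 amono asup [b [c hbc]]].
have hA : approximates (range a) x.
  split.
  - by exists (a i0), i0.
  - by move=> _ [i _ <-].
  - move=> _ _ [i _ <-] [j _ <-]; have [k [ik jk]] := dir i j.
    by exists (a k); split; [exists k|exact: amono|exact: amono].
  - by rewrite image_comp.
split => //; apply: (approximates_dom hA (w := c)) => _ [_ [i _ <-] <-].
by have /andP[] := hbc i.
Qed.

Lemma in_dom_net x : in_dom x ->
  approx_net iota T (fun s t : {a | below x a} => sval s <= sval t) sval x.
Proof.
move=> hx; have [x0 [w wub]] := hx.
have hA := approximates_below hEu x0; split.
- exact: directed_approximates hA.
- by move=> [a []].
- by [].
- have -> : range (iota \o (fun s : {a | below x a} => sval s)) = iota @` below x.
    apply/seteqP; split => [_ [[a ha] _ <-]|_ [a ha <-]]; first by exists a.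
    by exists (exist _ a ha).
  exact: below_sup.
- exists 0, w => -[a ha] /=; rewrite iota_ge0// T_ge0; last by case: ha.
  by apply: wub; exists a.
Qed.

Lemma nat_dom_posP x : nat_dom_pos iota T x <-> in_dom x.
Proof.
split => [[_ [I [leI [a /approx_netP[]]]]]//|hx]; split; first by case: hx.
by exists {a | below x a}, (fun s t => sval s <= sval t), sval; exact: in_dom_net hx.
Qed.

Lemma ext_posP x z : ext_pos iota T x z <-> in_dom x /\ z = Tpos x.
Proof.
split.
  move=> [I [leI [a [/approx_netP[hA hx] hz]]]]; split => //.
  by apply: supremums_uniq hz _; have := Tpos_approx hA hx; rewrite image_comp.
move=> [hx ->]; exists {a | below x a}, (fun s t => sval s <= sval t), sval.
split; first exact: in_dom_net hx.
have -> : range ((iota \o T) \o (fun s : {a | below x a} => sval s)) = iotaT @` below x.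
  apply/seteqP; split => [_ [[a ha] _ <-]|_ [a ha <-]]; first by exists a.
  by exists (exist _ a ha).
exact: Tpos_sup.
Qed.

Local Notation L1 := (L1 iota T).
Local Notation Text := (Text iota T).

Lemma L1P x : L1 x <-> in_dom (rabs x).
Proof.
split.
  move=> [u [v [/nat_dom_posP hu /nat_dom_posP hv ->]]].
  have [huv _] := TposD hu hv; apply: in_dom_le huv; first exact: rabs_ge0.
  have [u0 _] := hu; have [v0 _] := hv.
  by apply: rabs_le; [apply: (le_lin2 v0 v0)|apply: (le_lin2 u0 u0)]; lmod.
move=> hx; exists (rpos x), (rpos (- x)); split; last by rewrite rposB.
  by apply/nat_dom_posP; apply: in_dom_le hx; rewrite ?rpos_ge0 ?rpos_le_rabs.
by apply/nat_dom_posP; apply: in_dom_le hx; rewrite ?rpos_ge0// -rabsN rpos_le_rabs.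
Qed.

Lemma L1_pos x : 0 <= x -> (L1 x <-> in_dom x).
Proof. by move=> x0; rewrite L1P rabs_id. Qed.

Lemma L1_solid x y : rabs x <= rabs y -> L1 y -> L1 x.
Proof. by move=> xy; rewrite !L1P; apply: in_dom_le => //; exact: rabs_ge0. Qed.

Lemma L1_between x y : 0 <= x -> x <= y -> L1 y -> L1 x.
Proof.
by move=> x0 xy; apply: L1_solid; rewrite !rabs_id// (le_trans x0).
Qed.

Lemma L1D x y : L1 x -> L1 y -> L1 (x + y).
Proof.
rewrite !L1P => hx hy; have [h _] := TposD hx hy.
by apply: in_dom_le h; [exact: rabs_ge0|exact: rabsD].
Qed.

Lemma L1Z (k : R) x : L1 x -> L1 (k *: x).
Proof. by rewrite !L1P rabsZ => hx; exact: (TposZ (normr_ge0 k) hx).1. Qed.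

Lemma L1N x : L1 x -> L1 (- x).
Proof. by rewrite !L1P rabsN. Qed.

Lemma TextE u v : in_dom u -> in_dom v -> Text (u - v) = Tpos u - Tpos v.
Proof.
move=> hu hv; rewrite /Defs.Text; set S := (X in xget 0 X).
have : S (xget 0 S).
  apply: xgetPex; exists (Tpos u - Tpos v), u, v, (Tpos u), (Tpos v).
  by split => //; apply/ext_posP.
move=> [u' [v' [zu [zv [/ext_posP[hu' ->] /ext_posP[hv' ->] E1 ->]]]]].
have E2 : u + v' = u' + v.
  by have -> : u = u' - v' + v by [rewrite -E1; lmod]; lmod.
have [_ h1] := TposD hu hv'; have [_ h2] := TposD hu' hv.
have E3 : Tpos u + Tpos v' = Tpos u' + Tpos v by rewrite -h1 -h2 E2.
have -> : Tpos u = Tpos u' + Tpos v - Tpos v' by rewrite -E3; lmod.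
by lmod.
Qed.

Lemma Text_pos x : in_dom x -> Text x = Tpos x.
Proof.
move=> hx; have [x0 _] := hx; have h0 : in_dom 0 by apply: in_dom_le hx.
have T0 : Tpos 0 = 0.
  by have [_] := TposZ (lexx 0) hx; rewrite !scale0r.
by rewrite -{1}(subr0 x) TextE// T0 subr0.
Qed.

Lemma L1_dec x : L1 x -> exists u v, [/\ in_dom u, in_dom v & x = u - v].
Proof.
by move=> [u [v [/nat_dom_posP hu /nat_dom_posP hv ->]]]; exists u, v.
Qed.

Lemma TextD x y : L1 x -> L1 y -> Text (x + y) = Text x + Text y.
Proof.
move=> /L1_dec[u [v [hu hv ->]]] /L1_dec[u' [v' [hu' hv' ->]]].
have [h1 E1] := TposD hu hu'; have [h2 E2] := TposD hv hv'.
have -> : u - v + (u' - v') = (u + u') - (v + v') by lmod.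
by rewrite !TextE// E1 E2; lmod.
Qed.

Lemma TextZ (k : R) x : L1 x -> Text (k *: x) = k *: Text x.
Proof.
move=> /L1_dec[u [v [hu hv ->]]]; have [k0|k0] := leP 0 k.
  have [h1 E1] := TposZ k0 hu; have [h2 E2] := TposZ k0 hv.
  by rewrite scalerBr !TextE// E1 E2; lmod.
have k0' : 0 <= - k by rewrite oppr_ge0 ltW.
have [h1 E1] := TposZ k0' hu; have [h2 E2] := TposZ k0' hv.
have -> : k *: (u - v) = (- k) *: v - (- k) *: u by lmod.
by rewrite !TextE// E1 E2; lmod.
Qed.

Lemma Text_ge0 x : 0 <= x -> L1 x -> 0 <= Text x.
Proof. by move=> x0 /L1_pos h; rewrite Text_pos ?Tpos_ge0//; exact: h. Qed.

Lemma Text_le x y : L1 x -> L1 y -> x <= y -> Text x <= Text y.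
Proof.
move=> hx hy; rewrite -vsubr_ge0 => xy0.
have hyx : L1 (y - x) by apply: L1D => //; exact: L1N.
have : 0 <= Text (y - x) by exact: Text_ge0.
have -> : y - x = y + (-1) *: x by lmod.
rewrite TextD//; last exact: L1Z.
by rewrite TextZ// => h; apply: (le_lin1 h); lmod.
Qed.

Lemma Text_iota a : 0 <= a -> L1 (iota a) /\ Text (iota a) = iota (T a).
Proof.
move=> a0; have a0' : 0 <= iota a by rewrite iota_ge0.
have s : supremums (iotaT @` below (iota a)) (iota (T a)).
  split => [_ [b [b0 ba] <-]|w]; last by apply; exists a.
  by rewrite (iota_le hEu) T_le// -(iota_le hEu).
have ha : in_dom (iota a) by split => //; exists (iota (T a)); exact: s.1.
by rewrite L1_pos// Text_pos// (supremums_uniq (Tpos_sup ha) s).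
Qed.

End Extension.

(** * Sets with infimum zero *)

Section NullFamilies.
Context {R : realType} {V : rieszType R}.
Implicit Types (u v w x y z : V) (U : set V).

(** Nonemptiness makes [null_inf_le] hold for [k = 0] as well. *)
Definition null_inf U := U !=set0 /\ forall w, (forall u, U u -> w <= u) -> w <= 0.

Lemma null_inf_le U (k : R) w x : null_inf U -> 0 <= k ->
  (forall u, U u -> w <= x + k *: u) -> w <= x.
Proof.
move=> [[u0 Uu0] hU]; rewrite le_eqVlt => /predU1P[<-|k0] h.
  by have := h _ Uu0; rewrite scale0r addr0.
have kk : k * k^-1 = 1 by rewrite mulfV ?gt_eqF.
have : k^-1 *: (w - x) <= 0.
  apply: hU => u Uu; rewrite -(vler_pZ _ _ k0) scalerA kk scale1r.
  by apply: (le_lin1 (h _ Uu)); lmod.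
move=> /(vler_wZ (ltW k0)); rewrite scalerA kk scale1r scaler0 => h1.
by apply: (le_lin1 h1); lmod.
Qed.

End NullFamilies.

(** * The unit of the universal completion *)

Section Convergence.
Context {R : realType} {E Eu : rieszType R}.
Context (e : E) (T : {linear E -> E}) (hT : conditional_riesz_triple e T).
Context (iota : {linear E -> Eu}) (hEu : universal_completion iota).
Implicit Types (u v w x y z g h : Eu).

Let hV : dedekind_complete [set: Eu] := uc_complete hEu.
Let hL : @laterally_complete R Eu := uc_laterally_complete hEu.
Local Notation e' := (iota e).
Local Notation L1 := (L1 iota T).
Local Notation Text := (Text iota T).
Local Notation in_dom := (in_dom T iota).
Local Notation above y t := (band_proj (rpos (y - t *: e'))).

Lemma unit_ge0 : 0 <= e'.
Proof. by rewrite (iota_ge0 hEu); case: (crt_unit hT). Qed.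

(** Order density reduces this to [E], where [e] is a weak order unit. *)
Lemma unit_total q : rdisjoint e' q -> q = 0.
Proof.
move=> eq0; apply: contrapT => q0.
have aq0 : 0 < rabs q.
  by rewrite lt_def rabs_ge0 andbT; apply/eqP => /rabs_eq0.
have [x /andP[x0 xq]] := uc_order_dense hEu aq0.
have x_ge0 : 0 <= x by rewrite -(iota_ge0 hEu) ltW.
have [e0 band_e] := crt_unit hT.
suff xz : x = 0 by move: x0; rewrite xz linear0 ltxx.
apply: rdisjoint_self; apply: (@band_of_disjoint _ _ e); last by rewrite band_e.
apply: rdisjointP; rewrite !rabs_id// -(iota_le hEu) (uc_meet hEu) linear0 -eq0.
by rewrite rabs_id ?unit_ge0// rmeet_le2.
Qed.

Let e0 := unit_ge0.
Let eU := unit_total.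

Lemma L1_unit : L1 e' /\ Text e' = e'.
Proof.
have [e_ge0 _] := crt_unit hT; have [h E1] := Text_iota hT hEu e_ge0.
by split => //; rewrite E1 (ce_unit (crt_ce hT)).
Qed.

Lemma L1_Zunit (k : R) : L1 (k *: e').
Proof. by apply: (L1Z hT hEu); case: L1_unit. Qed.

(** * Order convergence to zero *)

Definition eventual_bound (I : Type) (leI : I -> I -> Prop) (x : I -> Eu) : set Eu :=
  [set v | L1 v /\ exists i0, forall i, leI i0 i -> rabs (x i) <= v].

(** The eventual bounds of [x] are directed downwards, hence themselves form a
    net dominating [x]. *)
Lemma order_cvg0P (I : Type) (leI : I -> I -> Prop) (x : I -> Eu) : directed leI ->
  order_cvg L1 leI x 0 <-> null_inf (eventual_bound leI x).
Proof.
move=> [_ refl tr dir]; split.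
  move=> [J [leJ [v [[[j0] _ _ _] _ [vL [_ _ vinf]] vb]]]].
  have ev j : eventual_bound leI x (v j).
    split; first by apply: vL; exists j.
    have [i0 h] := vb j; exists i0 => i /h.
    by have -> : x i - 0 = x i by lmod.
  split; first by exists (v j0).
  move=> w hw; apply: le_trans (le_rpos _) _; apply: vinf.
    apply: (L1_between hT hEu (rpos_ge0 w) _ (ev j0).1).
    have [_ [i0 h]] := ev j0; apply: rpos_le; last exact: hw.
    exact: le_trans (rabs_ge0 _) (h _ (refl i0)).
  move=> _ [j _ <-]; have [_ [i0 h]] := ev j.
  by apply: rpos_le; [exact: le_trans (rabs_ge0 _) (h _ (refl i0))|exact: hw].
move=> [[v0 hv0] hinf].
exists {v | eventual_bound leI x v}, (fun s t => sval t <= sval s), sval.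
split => //.
- split.
  + by exists; exists v0.
  + by move=> s /=.
  + by move=> s t u st tu; exact: le_trans tu st.
  + move=> [s [Ls [i hi]]] [t [Lt [j hj]]].
    have [k [ik jk]] := dir i j.
    have ev : eventual_bound leI x (rmeet s t).
      split; last first.
        exists k => l kl; apply: rmeet_glb; first exact/hi/(tr _ _ _ ik).
        exact/hj/(tr _ _ _ jk).
      apply: (L1_between hT hEu _ (rmeetl s t) Ls); apply: rmeet_ge0.
        exact: le_trans (rabs_ge0 _) (hi _ (refl _)).
      exact: le_trans (rabs_ge0 _) (hj _ (refl _)).
    by exists (exist _ _ ev); rewrite /= rmeetl rmeetr.
- split; first by move=> _ [[v [Lv ?]] _ <-].
  split.
  + by apply: (L1_between hT hEu (lexx 0) unit_ge0); case: L1_unit.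
  + move=> _ [[v [Lv [i hi]]] _ <-] /=.
    exact: le_trans (rabs_ge0 _) (hi _ (refl _)).
  + move=> w _ wlb; apply: hinf => v hv.
    by apply: wlb; exists (exist _ v hv).
- move=> [v [Lv [i hi]]] /=; exists i => j /hi.
  by have -> : x j - 0 = x j by lmod.
Qed.

Definition le_nat (m n : nat) : Prop := (m <= n)%N.

Lemma directed_nat : directed le_nat.
Proof.
split => [|n|m n k|m n]; rewrite /le_nat//.
- by exists; exact: 0%N.
- exact: leq_trans.
- by exists (maxn m n); rewrite leq_maxl leq_maxr.
Qed.

Lemma directed_real : directed (fun c d : R => c <= d : Prop).
Proof.
split => [|c|c d f|c d] //; first by exists; exact: 0.
  exact: le_trans.
by exists (Num.max c d); rewrite !le_max !lexx orbT.
Qed.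

Lemma eventual_bound_ge0 (x : nat -> Eu) v : eventual_bound le_nat x v -> 0 <= v.
Proof. by move=> [_ [n h]]; apply: le_trans (rabs_ge0 _) (h n (leqnn n)). Qed.

(** * Truncations at multiples of the unit *)

Lemma rpos_subE x y : rpos (x - y) = x - rmeet x y.
Proof.
have -> : rmeet x y = x + y - rjoin x y by exact: rmeetE.
have -> : rjoin x y = rpos (x - y) + y.
  by rewrite /rpos rjoinD; congr rjoin; lmod.
by lmod.
Qed.

Lemma excess_null y : 0 <= y ->
  null_inf [set rpos (y - k%:R *: e') | k in [set: nat]].
Proof.
move=> y0; split; first by exists (rpos (y - 0%:R *: e')), 0%N.
move=> w hw; have [_ h] := meet_unit_sup hV e0 eU y0.
have : y <= y - w; last by move=> h1; apply: (le_lin1 h1); lmod.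
apply: h => _ [k _ <-].
have h1 : w <= rpos (y - k%:R *: e') by apply: hw; exists k.
by rewrite rpos_subE in h1; apply: (le_lin1 h1); lmod.
Qed.

Lemma trunc_dom y k : in_dom y -> in_dom (rmeet y (k%:R *: e')).
Proof.
move=> hy; have [y0 _] := hy.
by apply: in_dom_le hy; rewrite ?rmeetl// rmeet_ge0// vscale_ge0.
Qed.

Lemma trunc_directed y :
  forall x z, [set rmeet y (k%:R *: e') | k in [set: nat]] x ->
    [set rmeet y (k%:R *: e') | k in [set: nat]] z ->
  exists t, [/\ [set rmeet y (k%:R *: e') | k in [set: nat]] t, x <= t & z <= t].
Proof.
move=> _ _ [m _ <-] [n _ <-]; exists (rmeet y ((maxn m n)%:R *: e')).
by split; [exists (maxn m n)| |]; rewrite // rmeet_le2 ?le_unit ?ler_nat// ?leq_maxl ?leq_maxr.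
Qed.

(** Monotone convergence of [T (rmeet y (k%:R *: e'))] to [T y]. *)
Lemma Text_excess_null y : in_dom y ->
  null_inf [set Text (rpos (y - k%:R *: e')) | k in [set: nat]].
Proof.
move=> hy; have [y0 _] := hy; split; first by exists (Text (rpos (y - 0%:R *: e'))), 0%N.
move=> w hw; have [||_ h] := @Tpos_monotone _ _ _ _ _ hT _ hEu _ y _ _
  (@trunc_directed y) (meet_unit_sup hV e0 eU y0) hy.
- by exists (rmeet y (0%:R *: e')), 0%N.
- by move=> _ [k _ <-]; exact: trunc_dom.
have : Tpos T iota y <= Tpos T iota y - w; last by move=> h1; apply: (le_lin1 h1); lmod.
apply: h => _ [_ [k _ <-] <-].
have h1 : w <= Text (rpos (y - k%:R *: e')) by apply: hw; exists k.
rewrite rpos_subE (TextE hT hEu hy (trunc_dom k hy)) in h1.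
by apply: (le_lin1 h1); lmod.
Qed.

(** The range of the extension is closed under suprema: the fixed points of [T]
    below [s] approximate [s]. *)
Lemma sup_range_dom (G : set Eu) s : G !=set0 -> (forall g, G g -> in_dom g) ->
  supremums (Text @` G) s -> in_dom s.
Proof.
move=> [g0 Gg0] hG [sub slub].
pose A : set E := [set b | [/\ 0 <= b, T b = b & iota b <= s]].
have fixA a g : G g -> below iota g a -> A (T a).
  move=> Gg ag; have [a0 _] := ag; split; first exact: (T_ge0 hT a0).
    exact: (ce_proj (crt_ce hT) a).
  apply: le_trans (sub _ (imageP _ Gg)).
  by rewrite (Text_pos hT hEu (hG _ Gg)); apply: (Tpos_sup hEu (hG _ Gg)).1; exists a.
have hA : approximates iota A s.
  split.
  - exists (T 0); apply: (fixA 0 g0) => //; split; rewrite ?linear0//.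
    by case: (hG _ Gg0).
  - by move=> a [].
  - move=> a b [a0 Ta as_] [b0 Tb bs]; exists (rjoin a b); split; rewrite ?rjoinl ?rjoinr//.
    have Ra : range T a by exists a.
    have Rb : range T b by exists b.
    have [[c _ Tc] _] := ce_range_riesz (crt_ce hT) Ra Rb.
    split; first exact: le_trans a0 (rjoinl _ _).
      by rewrite -Tc (ce_proj (crt_ce hT)).
    by rewrite (uc_join hEu) rjoin_lub.
  - split => [_ [b [_ _ bs] <-]//|w wub]; apply: slub => _ [g Gg <-].
    rewrite (Text_pos hT hEu (hG _ Gg)); apply: (Tpos_sup hEu (hG _ Gg)).2.
    by move=> _ [a ha <-]; apply: wub; exists (T a) => //; exact: fixA ha.
by apply: (approximates_dom hT hEu hA (w := s)) => _ [b [_ Tb bs] <-]; rewrite Tb.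
Qed.

Lemma L1_Text y : in_dom y -> L1 (Text y).
Proof.
move=> hy; have [y0 _] := hy.
have Ty0 : 0 <= Text y by rewrite (Text_pos hT hEu hy) (Tpos_ge0 hEu).
apply/(L1_pos hT hEu Ty0); apply: (@sup_range_dom [set y]); first by exists y.
  by move=> _ ->.
by split => [_ [_ -> <-]//|w]; apply; exists y.
Qed.

End Convergence.

(** * The conditional Vitali theorem *)

Section VitaliConvergence.
Context {R : realType} {E Eu : rieszType R}.
Context (e : E) (T : {linear E -> E}) (hT : conditional_riesz_triple e T).
Context (iota : {linear E -> Eu}) (hEu : universal_completion iota).
Context (p : R) (hp : 1 <= p).
Implicit Types (u v w x y z g h : Eu).

Let hV : dedekind_complete [set: Eu] := uc_complete hEu.
Let hL : @laterally_complete R Eu := uc_laterally_complete hEu.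
Local Notation e' := (iota e).
Local Notation L1 := (L1 iota T).
Local Notation Text := (Text iota T).
Local Notation in_dom := (in_dom T iota).
Local Notation above y t := (band_proj (rpos (y - t *: e'))).
Local Notation eventual_bound := (eventual_bound T iota).
Local Notation power x := (rpow e' (rabs x) p).

Let e0 : 0 <= e' := unit_ge0 hT hEu.
Let eU : forall q, rdisjoint e' q -> q = 0 := @unit_total _ _ _ _ _ hT _ hEu.
Let p_gt0 : 0 < p. Proof. exact: lt_le_trans hp. Qed.
Let pV_gt0 : 0 < p^-1. Proof. by rewrite invr_gt0. Qed.
Let p_neq0 : p != 0. Proof. by rewrite gt_eqF. Qed.

Let L1D' := L1D hT hEu.
Let L1Z' := L1Z hT hEu.
Let L1_le := L1_between hT hEu.
Let TD := TextD hT hEu.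
Let TZ := TextZ hT hEu.
Let T_mono := Text_le hT hEu.
Let dom_L1 y (y0 : 0 <= y) := L1_pos hT hEu y0.
Let powr_ge0 y := rpow_ge0 hV hL e0 eU (rabs_ge0 y) p_gt0.

Lemma order_cvg0_le (x y : nat -> Eu) (k : R) : 0 <= k ->
  (forall n, rabs (x n) <= k *: rabs (y n)) ->
  order_cvg L1 le_nat y 0 -> order_cvg L1 le_nat x 0.
Proof.
move=> k0 xy /(order_cvg0P hT hEu _ directed_nat) hy.
apply/(order_cvg0P hT hEu _ directed_nat).
have ev v : eventual_bound le_nat y v -> eventual_bound le_nat x (k *: v).
  move=> [Lv [n h]]; split; first exact: L1Z'.
  by exists n => m /h hm; apply: le_trans (xy m) (vler_wZ k0 hm).
split; first by have [[v /ev hv] _] := hy; exists (k *: v).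
move=> w hw; apply: (null_inf_le hy k0) => v /ev /hw.
by rewrite add0r.
Qed.

(** Passing between [T g] and its [p]-th root. The root is below
    [delta *: e' + delta `^ (1 - p) *: T g]. Conversely the tail of [T g] has a
    supremum [s], as it lies below the [p]-th power of a bound of the roots, and
    [s] belongs to [L1] because the range of [T] is closed under suprema; this
    allows the excess of [T g] over a constant to be removed. *)
Lemma root_cvg0 (g : nat -> Eu) : (forall n, in_dom (g n)) ->
  order_cvg L1 le_nat (fun n => rpow e' (Text (g n)) p^-1) 0 <->
  order_cvg L1 le_nat (fun n => Text (g n)) 0.
Proof.
move=> hg; have g0 n : 0 <= g n by case: (hg n).
have Tg0 n : 0 <= Text (g n).
  by apply: (Text_ge0 hT hEu) => //; apply/dom_L1.
have N0 n : 0 <= rpow e' (Text (g n)) p^-1 by apply: rpow_ge0.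
split=> /(order_cvg0P hT hEu _ directed_nat) hc;
  apply/(order_cvg0P hT hEu _ directed_nat); have [[v0 hv0] _] := hc.
- have [Lv0 [n0 hn0]] := hv0; have v0_ge0 := eventual_bound_ge0 hv0.
  pose G := [set g n | n in [set n | (n0 <= n)%N]].
  have Tv0 n : (n0 <= n)%N -> Text (g n) <= rpow e' v0 p.
    move=> n0n; apply: (le_of_root_le hV hL e0 eU hp) => //.
    by have := hn0 _ n0n; rewrite rabs_id.
  have [||s hs] := sup_exists hV (A := Text @` G) (b := rpow e' v0 p).
  + by exists (Text (g n0)), (g n0) => //; exists n0; rewrite /= ?leqnn.
  + by move=> _ [_ [n n0n <-] <-]; exact: Tv0.
  have hsd : in_dom s.
    apply: (@sup_range_dom _ _ _ _ _ hT _ hEu G) => //.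
      by exists (g n0), n0; rewrite /= ?leqnn.
    by move=> _ [n _ <-].
  have [s0 _] := hsd.
  have sg n : (n0 <= n)%N -> Text (g n) <= s.
    by move=> n0n; apply: hs.1; exists (g n) => //; exists n.
  have ev (K : R) v : 0 < K -> eventual_bound le_nat (fun n => rpow e' (Text (g n)) p^-1) v ->
      eventual_bound le_nat (fun n => Text (g n))
        (K `^ (p - 1) *: v + 2 *: rpos (s - (K `^ p / 2) *: e')).
    move=> K0 [Lv [n hn]]; split.
      apply: L1D'; first exact: L1Z'.
      apply: L1Z'; apply: (L1_le (rpos_ge0 _) _ ((dom_L1 s0).2 hsd)).
      apply: rpos_le => //; have KK : 0 <= (K `^ p / 2) *: e'.
        by rewrite vscale_ge0// divr_ge0// powR_ge0.
      by apply: (le_lin1 KK); lmod.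
    exists (maxn n0 n) => m; rewrite /le_nat geq_max => /andP[n0m nm].
    rewrite rabs_id//; apply: le_trans (le_root_cut hV hL e0 eU hp (Tg0 m) (sg _ n0m) K0) _.
    have := vler_wZ (powR_ge0 K (p - 1)) (hn _ nm); rewrite rabs_id// => h1.
    by apply: (le_lin1 h1); lmod.
  split; first by exists (1 `^ (p - 1) *: v0 + 2 *: rpos (s - (1 `^ p / 2) *: e')); exact: ev.
  move=> w hw.
  apply: (null_inf_le (excess_null hT hEu s0) (ler0n R 2)) => _ [k _ <-]; rewrite add0r.
  (* [K `^ p / 2] is [k.+1]; passing from [k] to [k.+1] keeps [K] positive. *)
  pose K := (2 * k.+1%:R) `^ p^-1 : R.
  have K0 : 0 < K by rewrite powR_gt0// mulr_gt0.
  apply: (@le_trans _ _ (2 *: rpos (s - (K `^ p / 2) *: e'))).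
    apply: (null_inf_le hc (powR_ge0 K (p - 1))) => v hv.
    by have := hw _ (ev _ _ K0 hv) => h1; apply: (le_lin1 h1); lmod.
  apply: vler_wZ => //; apply: rpos_le2.
  have -> : K `^ p / 2 = k.+1%:R.
    by rewrite powRVK ?mulr_ge0// mulrC mulKf// pnatr_eq0.
  have h1 : k%:R *: e' <= k.+1%:R *: e' by rewrite le_unit// ler_nat.
  by apply: (le_lin1 h1); lmod.
- have ev (d : R) v : 0 < d -> eventual_bound le_nat (fun n => Text (g n)) v ->
      eventual_bound le_nat (fun n => rpow e' (Text (g n)) p^-1)
        (d *: e' + d `^ (1 - p) *: v).
    move=> d0 [Lv [n hn]]; split.
      apply: L1D'; last exact: L1Z'.
      exact: (L1_Zunit hT hEu).
    exists n => m /hn; rewrite !rabs_id// => h1.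
    apply: le_trans (rpow_root_le hV hL e0 eU hp (Tg0 m) d0) _.
    have h2 := vler_wZ (powR_ge0 d (1 - p)) h1.
    by apply: (le_lin1 h2); lmod.
  split; first by exists (1 *: e' + 1 `^ (1 - p) *: v0); exact: ev.
  move=> w hw; apply: (@archimedean_eps _ _ hV e') => d d0.
  apply: (null_inf_le hc (powR_ge0 d (1 - p))) => v hv.
  exact/hw/ev.
Qed.

Lemma power_sub_le x y : power (x - y) <= 2 `^ p *: (power x + power y).
Proof. by rewrite -(rabsN y); exact: rpow_add_le. Qed.

Lemma in_dom_power_sub x y : in_dom (power x) -> in_dom (power y) ->
  in_dom (power (x - y)).
Proof.
move=> hx hy; have [hxy _] := TposD hT hEu hx hy.
have [h _] := TposZ hT hEu (powR_ge0 2 p) hxy.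
exact: in_dom_le (powr_ge0 _) (power_sub_le x y) h.
Qed.

Context (f_ : nat -> Eu) (f : Eu) (hf_ : forall n, in_dom (power (f_ n))).

Let Y n := power (f_ n).
Let G := power f.
Let g n := power (f_ n - f).
Let A : R := 2 `^ p.
Let P (eps : R) n := above (rabs (f_ n - f)) eps e'.
Let tailT (c : R) n := Text (above (Y n) c (Y n)).
Let Y0 n : 0 <= Y n := powr_ge0 (f_ n).
Let G0 : 0 <= G := powr_ge0 f.
Let g0 n : 0 <= g n := powr_ge0 (f_ n - f).
Let A0 : 0 <= A := powR_ge0 2 p.
Let LY n : L1 (Y n). Proof. exact: ((dom_L1 (Y0 n)).2 (hf_ n)). Qed.
Let bnd := above_bounds hV.

Let P_bounds eps n : 0 <= P eps n <= e'.
Proof. exact: bnd. Qed.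

Let LP eps n : L1 (P eps n).
Proof.
by have [h1 h2] := andP (P_bounds eps n); apply: (L1_le h1 h2 (L1_unit hT hEu).1).
Qed.

Let LaboveY c n : L1 (above (Y n) c (Y n)).
Proof. by have [h1 h2] := andP (bnd e' (Y n) c (Y0 n)); apply: (L1_le h1 h2 (LY n)). Qed.

Let T_pos x : 0 <= x -> L1 x -> 0 <= Text x.
Proof. exact: (Text_ge0 hT hEu). Qed.

Let L0 : L1 0.
Proof. exact: L1_le (lexx 0) e0 (L1_unit hT hEu).1. Qed.

Let LT y : 0 <= y -> L1 y -> L1 (Text y).
Proof. by move=> y0 /(dom_L1 y0); exact: (L1_Text hT hEu). Qed.

Let Lexcess y (k : R) : 0 <= y -> 0 <= k -> L1 y -> L1 (rpos (y - k *: e')).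
Proof.
move=> y0 k0; apply: L1_le (rpos_ge0 _) _; apply: rpos_le => //.
by apply: (le_lin1 (vscale_ge0 k0 e0)); lmod.
Qed.

Let Texcess_mono y (k k' : R) : 0 <= y -> 0 <= k -> k <= k' -> L1 y ->
  Text (rpos (y - k' *: e')) <= Text (rpos (y - k *: e')).
Proof.
move=> y0 k0 kk' hy; apply: T_mono; try exact: Lexcess.
  by apply: Lexcess => //; exact: le_trans kk'.
by apply: rpos_le2; have h1 := le_unit e0 kk'; apply: (le_lin1 h1); lmod.
Qed.

(** * From convergence in mean to uniformity *)

Section PowersConverge.
Context (hG : in_dom G) (hcvg : order_cvg L1 le_nat (fun n => Text (g n)) 0).

Let LG : L1 G. Proof. exact: ((dom_L1 G0).2 hG). Qed.
Let Lg n : L1 (g n).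
Proof. by apply/(dom_L1 (g0 n)); exact: in_dom_power_sub. Qed.
Let null_g := (order_cvg0P hT hEu _ directed_nat).1 hcvg.

Let Y_le n : Y n <= A *: (g n + G).
Proof.
have -> : Y n = power ((f_ n - f) - (- f)) by rewrite /Y; congr (power _); lmod.
by have := power_sub_le (f_ n - f) (- f); rewrite rabsN.
Qed.

(** Chebyshev's inequality under [T]. *)
Lemma cvg_prob_of_power : cvg_cond_prob iota e T le_nat f_ f.
Proof.
move=> eps eps0; have epsp : 0 < eps `^ p by exact: powR_gt0.
apply: (order_cvg0_le (k := (eps `^ p)^-1) _ _ hcvg).
  by rewrite invr_ge0 ltW.
move=> n; have [P0 _] := andP (P_bounds eps n).
rewrite (rabs_id (T_pos P0 (LP eps n))) (rabs_id (T_pos (g0 n) (Lg n))).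
rewrite -(vler_pZ _ _ epsp) scalerA mulfV ?gt_eqF// scale1r -TZ//.
by apply: T_mono => //; [exact: L1Z'|exact: chebyshev_rpow].
Qed.

Lemma powers_bounded : exists2 M, L1 M & forall n, Text (Y n) <= M.
Proof.
have [[v [Lv [n0 hv]]] _] := null_g.
have TY0 n : 0 <= Text (Y n) by exact: T_pos.
have TG0 : 0 <= Text G by exact: T_pos.
have Lsum m : L1 (\sum_(i < m) Text (Y i)).
  elim: m => [|m IH]; last by rewrite big_ord_recr /=; apply: L1D' => //; exact: LT.
  by rewrite big_ord0; exact: L0.
have sum0 m : 0 <= \sum_(i < m) Text (Y i).
  by elim: m => [|m IH]; rewrite ?big_ord0// big_ord_recr vaddr_ge0.
have v0 : 0 <= v by apply: le_trans (rabs_ge0 _) (hv n0 (leqnn n0)).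
exists (A *: (v + Text G) + \sum_(i < n0) Text (Y i)).
  by apply: L1D' => //; apply: L1Z'; apply: L1D' => //; exact: LT.
have AvG : 0 <= A *: (v + Text G) by rewrite vscale_ge0// vaddr_ge0.
move=> n; have [n0n|nn0] := leqP n0 n.
  have h1 : Text (Y n) <= A *: (Text (g n) + Text G).
    rewrite -TD// -TZ//; last exact: L1D'.
    by apply: T_mono => //; apply: L1Z'; exact: L1D'.
  have h2 : Text (g n) <= v by apply: le_trans (le_rabs _) (hv _ n0n).
  have h3 : A *: (Text (g n) + Text G) <= A *: (v + Text G).
    by apply: vler_wZ => //; apply: (le_lin1 h2); lmod.
  by apply: (le_lin2 (le_trans h1 h3) (sum0 n0)); lmod.
have : Text (Y n) <= \sum_(i < n0) Text (Y i).
  elim: n0 nn0 {hv AvG} => // m IH; rewrite ltnS leq_eqVlt big_ord_recr /=.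
  move=> /predU1P[->|/IH h]; first by apply: (le_lin1 (sum0 m)); lmod.
  by apply: (le_lin2 h (TY0 m)); lmod.
by move=> h; apply: (le_lin2 h AvG); lmod.
Qed.

(** The finitely many early terms are dominated by the excess of their sum; the
    others by [g n], a small multiple of [Y n], and the excess of [G]. *)
Lemma T_uniform_of_power : T_uniform iota e T (range Y).
Proof.
have [M LM hM] := powers_bounded.
have M0 : 0 <= M by apply: le_trans (hM 0%N); exact: T_pos.
pose S (c : R) := [set Text (band_proj (rpos (rabs x - c *: e')) (rabs x)) | x in range Y].
have SE c : S c = range (tailT c).
  apply/seteqP; split => [_ [_ [n _ <-] <-]|_ [n _ <-]]; first by exists n; rewrite // rabs_id.
  by exists (Y n); [exists n|rewrite rabs_id].
have tail0 c n : 0 <= tailT c n.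
  by apply: T_pos => //; have [] := andP (bnd e' (Y n) c (Y0 n)).
have tailM c n : tailT c n <= M.
  apply: le_trans (hM n); apply: T_mono => //.
  by have [] := andP (bnd e' (Y n) c (Y0 n)).
have sup_s c : supremums (S c) (supremum 0 (S c)).
  have [||z hz] := sup_exists hV (A := S c) (b := M).
  - by rewrite SE; exists (tailT c 0%N), 0%N.
  - by rewrite SE => _ [n _ <-].
  by rewrite (supremumE hz).
pose s c := supremum 0 (S c).
have s_ge0 c : 0 <= s c.
  by apply: le_trans (tail0 c 0%N) ((sup_s c).1 _ _); rewrite SE; exists 0%N.
have s_le c w : (forall n, tailT c n <= w) -> s c <= w.
  by move=> h; apply: (sup_s c).2; rewrite SE => _ [n _ <-].
exists s; split.
  exists 0 => c _; split.
  - by apply: (L1_le (s_ge0 c) _ LM); exact: s_le.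
  - exact: (sup_s c).1.
  - by move=> w _; exact: (sup_s c).2.
apply/(order_cvg0P hT hEu _ directed_real); split.
  by exists M; split => //; exists 0 => c _; rewrite rabs_id//; exact: s_le.
move=> w hw.
apply: (null_inf_le null_g A0) => v [Lv [n1 hv]].
apply: (null_inf_le (Text_excess_null hT hEu hG) A0) => _ [k _ <-].
have v0 : 0 <= v by apply: le_trans (rabs_ge0 _) (hv n1 (leqnn n1)).
pose Y' := \sum_(i < n1) Y i.
have Y'0 m : 0 <= \sum_(i < m) Y i.
  by elim: m => [|m IH]; rewrite ?big_ord0// big_ord_recr vaddr_ge0.
have LY' : L1 Y'.
  rewrite /Y'; elim: n1 {hv Y'} => [|m IH]; last by rewrite big_ord_recr /=; exact: L1D'.
  by rewrite big_ord0; exact: L0.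
have YY' n : (n < n1)%N -> Y n <= Y'.
  rewrite /Y'; elim: n1 {hv Y' LY'} => // m IH; rewrite ltnS leq_eqVlt big_ord_recr /=.
  move=> /predU1P[->|/IH h]; first by apply: (le_lin1 (Y'0 m)); lmod.
  by apply: (le_lin2 h (Y0 m)); lmod.
have hY' : in_dom Y' by apply/dom_L1 => //; exact: Y'0.
apply: (null_inf_le (Text_excess_null hT hEu hY') (ler0n R 2)) => _ [m _ <-].
set rest := _ + _ + _ + _.
have : w - rest <= 0; last by move=> h; apply: (le_lin1 h); lmod.
apply: (@archimedean_eps _ _ hV ((A * k%:R) *: M)) => eps eps0.
have TGk0 : 0 <= Text (rpos (G - k%:R *: e')).
  by apply: T_pos; [exact: rpos_ge0|exact: Lexcess].
have TYm0 : 0 <= Text (rpos (Y' - m%:R *: e')).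
  by apply: T_pos; [exact: rpos_ge0|apply: Lexcess => //; exact: Y'0].
have Ak0 : 0 <= A * k%:R by rewrite mulr_ge0.
have LTG : L1 (Text (rpos (G - k%:R *: e'))).
  by apply: LT (rpos_ge0 _) _; exact: Lexcess.
have LTY : L1 (Text (rpos (Y' - m%:R *: e'))).
  by apply: LT (rpos_ge0 _) _; apply: Lexcess => //; exact: Y'0.
have : w <= rest + eps *: ((A * k%:R) *: M); last by move=> h; apply: (le_lin1 h); lmod.
have epsM : 0 <= eps *: ((A * k%:R) *: M) by rewrite !vscale_ge0 ?(ltW eps0).
have Av0 := vscale_ge0 A0 v0; have AG0 := vscale_ge0 A0 TGk0.
have TY20 := vscale_ge0 (ler0n R 2) TYm0.
apply: hw; split.
  by rewrite /rest; do ?apply: L1D'; [exact: L0|do ?apply: L1Z'..].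
(* Beyond [2 * m] the early tails are below twice the excess of [Y'] over [m];
   beyond [eps^-1] the factor [k / c] is at most [eps * k]. *)
pose c0 := Num.max (2 * m%:R) eps^-1.
exists c0 => c; rewrite /c0 ge_max => /andP[mc epsc].
have ci0 : 0 < eps^-1 by rewrite invr_gt0.
have c_gt0 : 0 < c by exact: lt_le_trans epsc.
rewrite rabs_id//; apply: s_le => n; have [n1n|nn1] := leqP n1 n.
  have h1 := above_le_split hV (k := k%:R) e' A0 c_gt0 (ler0n _ _) (Y0 n) (g0 n) (Y_le n).
  have Lx := Lexcess G0 (ler0n R k) LG.
  have h2 := T_mono (LaboveY c n) _ h1.
  have {}h2 : tailT c n <= A *: Text (g n) + (A * (k%:R / c)) *: Text (Y n) +
      A *: Text (rpos (G - k%:R *: e')).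
    rewrite -!TZ// -!TD//; do ?[exact: L1Z'|apply: L1D'].
    by apply: h2; do ?[exact: L1Z'|apply: L1D'].
  have h3 : A *: Text (g n) <= A *: v.
    by apply: vler_wZ => //; apply: le_trans (le_rabs _) (hv _ n1n).
  have h4 : (A * (k%:R / c)) *: Text (Y n) <= eps *: ((A * k%:R) *: M).
    have Akc0 : 0 <= A * (k%:R / c) by rewrite mulr_ge0// divr_ge0// ltW.
    apply: le_trans (vler_wZ Akc0 (hM n)) _; rewrite scalerA.
    have : A * (k%:R / c) <= eps * (A * k%:R).
      have ceps : c^-1 <= eps^-1^-1 by rewrite lef_pV2// posrE.
      rewrite invrK in ceps; have := ler_wpM2l Ak0 ceps.
      by rewrite -mulrA (mulrC _ eps).
    rewrite -subr_ge0 => h; apply: (le_lin1 (vscale_ge0 h M0)); lmod.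
  rewrite /rest; apply: le_trans h2 _.
  have h5 : A *: Text (g n) + (A * (k%:R / c)) *: Text (Y n) <=
      A *: v + eps *: ((A * k%:R) *: M) by apply: (le_lin2 h3 h4); lmod.
  by apply: (le_lin2 h5 TY20); lmod.
have h1 : tailT c n <= 2 *: Text (rpos (Y' - m%:R *: e')).
  rewrite -TZ//; last by apply: Lexcess => //; exact: Y'0.
  apply: T_mono => //; first by apply: L1Z'; apply: Lexcess => //; exact: Y'0.
  apply: le_trans (above_le_cut hV e' (Y n) c) _; apply: vler_wZ => //.
  apply: rpos_le2; have mc2 : m%:R <= c / 2 by rewrite ler_pdivlMr// mulrC.
  by apply: (le_lin2 (YY' _ nn1) (le_unit e0 mc2)); lmod.
rewrite /rest; apply: le_trans h1 _.
apply: (le_lin2 (vaddr_ge0 Av0 AG0) epsM); lmod.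
Qed.

End PowersConverge.

(** * From uniformity to convergence in mean *)

Section UniformConverge.
Context (hU : T_uniform iota e T (range Y)).
Context (hP : cvg_cond_prob iota e T le_nat f_ f).

Let null_P eps (eps0 : 0 < eps) :
  null_inf (eventual_bound le_nat (fun n => Text (P eps n))) :=
  (order_cvg0P hT hEu _ directed_nat).1 (hP eps0).

(** The eventual bounds of the suprema [s c] bound all the tails beyond arbitrarily
    large levels [c]. *)
Let uniform_tails : exists2 U : set Eu, null_inf U &
  forall v, U v -> L1 v /\
    forall k : R, exists2 c, 0 <= c /\ k <= c & forall n, tailT c n <= v.
Proof.
have [s [[c0 hs] /(order_cvg0P hT hEu _ directed_real) hn]] := hU.
exists (eventual_bound (fun c d : R => c <= d : Prop) s) => // v [Lv [c1 hc1]].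
split => // k; pose c := Num.max (Num.max c0 c1) (Num.max 0 k).
exists c; first by rewrite !le_max !lexx !orbT.
move=> n; have cc1 : c1 <= c by rewrite !le_max lexx !orbT.
apply: le_trans (le_trans (le_rabs _) (hc1 _ cc1)).
have [|_ ub _] := hs c; first by rewrite !le_max lexx.
by apply: ub; exists (Y n); [exists n|rewrite rabs_id].
Qed.

Let Y_le_tail c n : 0 <= c -> Text (Y n) <= c *: e' + tailT c n.
Proof.
move=> c_ge0; have [Le Te] := L1_unit hT hEu.
rewrite -{1}Te -TZ// -TD//; last exact: L1Z'.
apply: T_mono => //; first by apply: L1D' => //; exact: L1Z'.
exact: le_add_above.
Qed.

(** Fatou's argument, on the truncations [rmeet G (k%:R *: e')]. *)
Lemma power_limit_dom : in_dom G.
Proof.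
have [U [[v Uv] _] hUv] := uniform_tails.
have [Lv /(_ 0)[c [c_ge0 _] hc]] := hUv _ Uv.
have [Le Te] := L1_unit hT hEu.
pose M := c *: e' + v.
have hM n : Text (Y n) <= M.
  by apply: le_trans (Y_le_tail n c_ge0) _; apply: (le_lin1 (hc n)); rewrite /M; lmod.
have trunc_dom_G k : in_dom (rmeet G (k%:R *: e')).
  have ke0 : 0 <= k%:R *: e' by rewrite vscale_ge0.
  apply: in_dom_le (rmeet_ge0 G0 ke0) (rmeetr _ _) _.
  by apply/(dom_L1 ke0); exact: (L1_Zunit hT hEu).
apply: (@Tpos_bounded_dom _ _ _ _ _ hT _ hEu [set rmeet G (k%:R *: e') | k in [set: nat]]
  G _ _ _ _ (A *: M + A *: e')).
- by exists (rmeet G (0%:R *: e')), 0%N.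
- by move=> _ [k _ <-].
- exact: (trunc_directed hT hEu).
- exact: (meet_unit_sup hV e0 eU G0).
move=> _ [k _ <-]; rewrite -(Text_pos hT hEu (trunc_dom_G k)).
apply: (null_inf_le (null_P ltr01) (ler0n R k)) => u [Lu [n hn]].
have GA : G <= A *: (Y n + g n).
  have -> : G = power (f_ n - (f_ n - f)) by rewrite /G; congr (power _); lmod.
  exact: power_sub_le.
have h1 := trunc_le_split hV hL e0 eU hp A0 (ler0n R k) ler01 (Y0 n) GA.
rewrite powR1 mulr1 in h1.
have LAY : L1 (A *: Y n) by exact: L1Z'.
have LAe : L1 (A *: e') by exact: L1Z'.
have LkP : L1 (k%:R *: P 1 n) by exact: L1Z'.
have h2 : Text (rmeet G (k%:R *: e')) <= A *: Text (Y n) + A *: e' + k%:R *: Text (P 1 n).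
  rewrite -{2}Te -!TZ// -!TD//; last exact: L1D'.
  apply: T_mono h1; last by do ?apply: L1D'.
  by apply/(dom_L1 _); [case: (trunc_dom_G k)|exact: trunc_dom_G].
have h3 := vler_wZ A0 (hM n).
have h4 := vler_wZ (ler0n R k) (le_trans (le_rabs _) (hn n (leqnn n))).
apply: le_trans h2 _; apply: (le_lin2 h3 h4); lmod.
Qed.

(** The eventual bounds come from [rpow_le_split]. Its terms are removed in this
    order: the probability term first, as its factor [2 * c] depends on the level
    chosen for the bound [v] of the tails and for [k], then [v], then the excess of
    [G] over [k], and [eps `^ p] last. *)
Lemma power_cvg_of_uniform : order_cvg L1 le_nat (fun n => Text (g n)) 0.
Proof.
have hG := power_limit_dom; have LG : L1 G := (dom_L1 G0).2 hG.
have [U nU hUv] := uniform_tails; have [[v0 Uv0] _] := nU.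
have [Le Te] := L1_unit hT hEu.
have Lg n : L1 (g n) by apply/(dom_L1 (g0 n)); exact: in_dom_power_sub.
have gA n : g n <= A *: (Y n + G) by exact: power_sub_le.
have ev (eps c : R) k v u : 0 < eps -> 0 <= c -> k%:R <= c -> L1 v ->
    (forall n, tailT c n <= v) ->
    eventual_bound le_nat (fun n => Text (P eps n)) u ->
    eventual_bound le_nat (fun n => Text (g n))
      (eps `^ p *: e' + A *: ((2 * c) *: u + v + Text (rpos (G - k%:R *: e')))).
  move=> eps0 c_ge0 kc Lv hv [Lu [n0 hn0]]; split.
    apply: L1D'; first exact: L1Z'.
    apply: L1Z'; apply: L1D'; first by apply: L1D' => //; exact: L1Z'.
    by apply: LT (rpos_ge0 _) _; exact: Lexcess.
  exists n0 => n n0n; rewrite rabs_id; last exact: T_pos.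
  have h1 := rpow_le_split hV hL e0 eU hp A0 c_ge0 (ltW eps0) (Y0 n) (gA n).
  have Lx := Lexcess G0 c_ge0 LG.
  have LcP : L1 ((2 * c) *: P eps n) by exact: L1Z'.
  have LPY := LaboveY c n.
  have Lee : L1 (eps `^ p *: e') by exact: L1Z'.
  have L2 := L1D' LcP LPY; have L3 := L1D' L2 Lx; have L4 := L1Z' A L3.
  have h2 := T_mono (Lg n) (L1D' Lee L4) h1.
  rewrite (TD Lee L4) (TZ _ Le) Te (TZ A L3) (TD L2 Lx) (TD LcP LPY) (TZ _ (LP eps n)) in h2.
  have c20 : 0 <= 2 * c by rewrite mulr_ge0.
  have h3 := vler_wZ c20 (le_trans (le_rabs _) (hn0 _ n0n)).
  have h4 := Texcess_mono G0 (ler0n R k) kc LG.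
  apply: le_trans h2 _.
  have h5 : (2 * c) *: Text (P eps n) + tailT c n + Text (rpos (G - c *: e')) <=
      (2 * c) *: u + v + Text (rpos (G - k%:R *: e')).
    have h6 : (2 * c) *: Text (P eps n) + tailT c n <= (2 * c) *: u + v.
      by apply: (le_lin2 h3 (hv n)); lmod.
    by apply: (le_lin2 h6 h4); lmod.
  by have h7 := vler_wZ A0 h5; apply: (le_lin1 h7); lmod.
apply/(order_cvg0P hT hEu _ directed_nat); split.
  have [[u hu] _] := null_P ltr01; have [Lv /(_ 0%:R)[c [c_ge0 kc] hc]] := hUv _ Uv0.
  by eexists; exact: (ev 1 c 0%N v0 u).
move=> w hw; apply: (@archimedean_eps _ _ hV e') => eta eta0.
pose eps := eta `^ p^-1; have eps0 : 0 < eps by exact: powR_gt0.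
have Eeps : eps `^ p = eta by rewrite powRVK// ltW.
apply: (null_inf_le (Text_excess_null hT hEu hG) A0) => _ [k _ <-].
apply: (null_inf_le nU A0) => v Uv.
have [Lv /(_ k%:R)[c [c_ge0 kc] hc]] := hUv _ Uv.
have A2c : 0 <= A * (2 * c) by rewrite !mulr_ge0.
apply: (null_inf_le (null_P eps0) A2c) => u hu.
have := hw _ (ev eps c k v u eps0 c_ge0 kc Lv hc hu); rewrite Eeps => h.
by apply: (le_lin1 h); lmod.
Qed.

End UniformConverge.

End VitaliConvergence.

Theorem theorem14 (R : realType) (E : rieszType R) (e : E)
    (T : {linear E -> E}) (hT : conditional_riesz_triple e T)
    (Eu : rieszType R) (iota : {linear E -> Eu})
    (hEu : universal_completion iota)
    (p : R) (hp : 1 <= p)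
    (f_ : nat -> Eu) (hf_ : forall n, Lp iota e T p (f_ n))
    (f : Eu) (hf : L1 iota T f) :
  (Lp iota e T p f /\
   order_cvg (L1 iota T) (fun m n : nat => (m <= n)%N)
     (fun n => Np iota e T p (f_ n - f)) 0)
  <->
  (T_uniform iota e T (range (fun n => rpow (iota e) (rabs (f_ n)) p)) /\
   cvg_cond_prob iota e T (fun m n : nat => (m <= n)%N) f_ f).
Proof.
have p0 : 0 < p by exact: lt_le_trans hp.
have pow0 x : 0 <= rpow (iota e) (rabs x) p.
  apply: (rpow_ge0 _ _ _ _ (rabs_ge0 x) p0); [exact: (uc_complete hEu)
    |exact: (uc_laterally_complete hEu)|exact: (unit_ge0 hT hEu)|].
  exact: (unit_total hT hEu).
have dom x : Lp iota e T p x -> in_dom T iota (rpow (iota e) (rabs x) p).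
  by move=> [_ /(L1_pos hT hEu (pow0 x))].
have hY n := dom _ (hf_ n).
split=> [[/dom hG hN]|[hU hP]].
  have hT0 := (root_cvg0 hT hEu hp (fun n => in_dom_power_sub hT hEu hp (hY n) hG)).1 hN.
  split; first exact: (T_uniform_of_power hT hEu hp hY hG hT0).
  exact: (cvg_prob_of_power hT hEu hp hY hG hT0).
have hG := power_limit_dom hT hEu hp hY hU hP; split.
  by split => //; apply/(L1_pos hT hEu (pow0 f)).
apply/(root_cvg0 hT hEu hp (fun n => in_dom_power_sub hT hEu hp (hY n) hG)).
exact: (power_cvg_of_uniform hT hEu hp hY hU hP).
Qed.
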